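(* Let $\overline\nu$ be a partition of $d$, with largest part $\nu_2$. Then there exists a polynomial $\widetilde k_{\overline\nu}(t_B)$ with rational coefficients in the variables $t_B$, where $B$ runs over the set of border strip classes of size $1\le|B|\le d$, such that, for all $n\ge d+\nu_2$ and all partitions $\lambda$ of $n$, the Kronecker coefficient ${\sf g}(\lambda,\lambda,(n-d,\overline\nu))$ is obtained from $\widetilde k_{\overline\nu}(t_B)$ by evaluating each $t_B$ at ${\sf r}_\lambda(B)$, that is, $$ {\sf g}(\lambda,\lambda,(n-d,\overline\nu)) = \widetilde k_{\overline\nu}({\sf r}_\lambda(B)). $$
   Context: For partitions $\lambda,\mu,\nu$ of $n$, ${\sf g}(\lambda,\mu,\nu)=\langle\chi^\lambda\otimes\chi^\mu,\chi^\nu\rangle$ is the Kronecker coefficient, where $\chi^\lambda$ is the irreducible character of the symmetric group ${\sf S}_n$ attached to $\lambda$. For a partition $\overline\nu=(\nu_2,\dots,\nu_r)$ of $d$ and $n\ge d+\nu_2$, $(n-d,\overline\nu)$ is the partition $(n-d,\nu_2,\dots,\nu_r)$ of $n$ (with $\nu_2=0$ if $\overline\nu$ is empty). A partition $\lambda$ is identified with its diagram $\{(i,j)\mid 1\le i\le \ell(\lambda),\ 1\le j\le\lambda_i\}\subset\mathbb N\times\mathbb N$. If $\alpha\subseteq\lambda$ are partitions, the skew diagram $\lambda/\alpha$ is the set of squares of $\lambda$ not in $\alpha$. Connectedness and connected components of skew diagrams refer to adjacency of squares along edges (connected diagrams are nonempty). Two skew diagrams are isomorphic if there is a bijection between their sets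 of connected components such that corresponding components are translates of one another. A diagram class is an isomorphism class $D=[\sigma]$ of skew diagrams, of size $|D|=|\sigma|$. A border strip is a connected skew diagram containing no $2\times2$ block of squares; a border strip class is the diagram class of a border strip. For a partition $\lambda$ and a diagram class $D$, ${\sf r}_\lambda(D)$ is the number of partitions $\alpha\subseteq\lambda$ such that $\lambda/\alpha$ belongs to $D$. *)

(* Defs.v *)
From HB Require Import structures.
From mathcomp Require Import all_boot all_order all_algebra all_fingroup
  all_solvable all_field all_character.
From mathcomp Require Import finmap boolp classical_sets functions cardinality.
From mathcomp Require Import mpoly zify.

Set Implicit Arguments.
Unset Strict Implicit.
Unset Printing Implicit Defensive.

Import GRing.Theory Num.Theory.
Local Open Scope fset_scope.
Local Open Scope ring_scope.

Section Partitions.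
Local Open Scope nat_scope.

Definition is_part (s : seq nat) : bool := sorted geq s && (0 \notin s).

Record part := Part { part_val :> seq nat; _ : is_part part_val }.

HB.instance Definition _ := [isSub for part_val].
HB.instance Definition _ := [Choice of part by <:].

(* The partition (n - d, nu_2, ..., nu_r) of n, where nu is a partition of d;
   no row of length 0 is added (this concerns only n = d = 0). *)
Definition add_first_row (n : nat) (nu : seq nat) : seq nat :=
  if n - sumn nu == 0 then nu else (n - sumn nu) :: nu.

End Partitions.

(* The stabilizers below are those of the tableau of shape la in which the
   numbers 0, ..., n-1 are written row by row: there k : 'I_n stands in row
   [reshape_index la k] and in column [reshape_offset la k], counted from 0. *)

Definition level_stab (n : nat) (f : 'I_n -> nat) : {set 'S_n} :=
  [set s : 'S_n | [forall k, f (s k) == f k]].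

Lemma level_stab_group_set (n : nat) (f : 'I_n -> nat) :
  group_set (level_stab f).
Proof.
apply/group_setP; split=> [|s t].
  by rewrite inE; apply/forallP=> k; rewrite perm1.
rewrite !inE => /forallP fs /forallP ft; apply/forallP=> k.
by rewrite permM (eqP (ft _)) fs.
Qed.

Canonical level_stab_group (n : nat) (f : 'I_n -> nat) :=
  Group (level_stab_group_set f).

Definition row_stab (n : nat) (la : seq nat) : {group 'S_n} :=
  [group of level_stab (fun k : 'I_n => reshape_index la k)].

Definition col_stab (n : nat) (la : seq nat) : {group 'S_n} :=
  [group of level_stab (fun k : 'I_n => reshape_offset la k)].

Lemma sgn_is_class_fun (n : nat) :
  is_class_fun <<[set: 'S_n]>>%g
    [ffun s : 'S_n => (-1 : algC) ^+ odd_perm s].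
Proof.
by rewrite genGid; apply: intro_class_fun => [x y _ _|x]; rewrite ?odd_permJ ?inE.
Qed.

Definition sgn_cfun (n : nat) : 'CF([set: 'S_n]) :=
  Cfun 0 (sgn_is_class_fun n).

(* The irreducible character chi^la of S_n attached to a partition la of n, as
   in James and Kerber: the only irreducible character which is a constituent
   both of the character induced from the trivial character of the row
   stabilizer of a tableau of shape la, and of the one induced from the sign
   character of its column stabilizer. When la is a partition of n there is
   exactly one such constituent, so that the default value 0 is never used;
   when la is not a partition of n the value of [chi] is meaningless. *)
Definition chi (n : nat) (la : seq nat) : 'CF([set: 'S_n]) :=
  'chi_(odflt 0 [pick i : Iirr [set: 'S_n] |
    (i \in irr_constt ('Ind[[set: 'S_n]] (1 : 'CF(row_stab n la)))) &&
    (i \in irr_constt ('Ind[[set: 'S_n]] ('Res[col_stab n la] (sgn_cfun n))))]).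

Definition kron (n : nat) (la mu nu : seq nat) : algC :=
  '[chi n la * chi n mu, chi n nu].

Section Diagrams.
Local Open Scope nat_scope.

Definition squares := {fset nat * nat}.

(* 1-based: (i, j) with 1 <= i <= size la and 1 <= j <= la_i. *)
Definition diagram (la : seq nat) : squares :=
  [fset x in [seq (i, j) | i <- iota 1 (size la), j <- iota 1 (nth 0 la i.-1)]].

Definition subpart (al la : part) : bool := diagram al `<=` diagram la.

Definition skew (la al : part) : squares := diagram la `\` diagram al.

Definition is_skew (s : squares) : Prop :=
  exists la al : part, subpart al la /\ s = skew la al.

Definition adj (x y : nat * nat) : bool :=
  ((x.1 == y.1) && ((x.2 == y.2.+1) || (y.2 == x.2.+1))) ||
  ((x.2 == y.2) && ((x.1 == y.1.+1) || (y.1 == x.1.+1))).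

Definition joined (s : squares) : rel s :=
  connect [rel x y : s | adj (val x) (val y)].

Definition connected (s : squares) : Prop :=
  s <> fset0 /\ forall x y : s, joined x y.

Definition component (s : squares) (x : s) : squares :=
  [fset val y | y : s & joined x y].

Definition components (s : squares) : {fset squares} :=
  [fset component x | x : s].

Definition translates (s t : squares) : Prop :=
  exists a b : int,
    [fset (Posz x.1 + a, Posz x.2 + b)%R | x in s] =
    [fset (Posz x.1, Posz x.2) | x in t].

Definition iso (s t : squares) : Prop :=
  exists f : components s -> components t,
    bijective f /\ forall c, translates (val c) (val (f c)).

Definition dclass (s : squares) : set squares :=
  [set t | is_skew t /\ iso s t]%classic.

Definition border_strip (s : squares) : Prop :=
  [/\ is_skew s, connected s &
      forall i j, ~ [/\ (i, j) \in s, (i, j.+1) \in s,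
                        (i.+1, j) \in s & (i.+1, j.+1) \in s]].

Definition bs_classes (d : nat) : set (set squares) :=
  [set D | exists s, [/\ border_strip s, 1 <= #|` s| <= d & D = dclass s]]%classic.

Lemma component_connected (s : squares) (x : s) :
  connected s -> component x = s.
Proof.
case=> _ cs; apply/fsetP=> y; apply/imfsetP/idP => [[z _ ->]|ys]; first exact: valP.
by exists [` ys] => //=; rewrite inE; apply: cs.
Qed.

Lemma components_connected (s : squares) :
  connected s -> components s = [fset s].
Proof.
move=> cs; apply/fsetP=> c; rewrite in_fset1; apply/imfsetP/eqP => [[x _ ->]|->].
  exact: component_connected.
case: (fset_0Vmem s) => [s0|[x xs]]; first by case: cs.
by exists [` xs] => //; rewrite component_connected.
Qed.

Lemma translates_sym (s t : squares) : translates s t -> translates t s.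
Proof.
case=> a [b e]; exists (- a)%R, (- b)%R; apply/fsetP=> x.
apply/imfsetP/imfsetP => /= [[y yt ->]|[y ys ->]].
  have : (Posz y.1, Posz y.2) \in [fset (Posz x.1, Posz x.2) | x in t].
    by apply/imfsetP; exists y.
  rewrite -e => /imfsetP[z /= zs [-> ->]]; exists z => //.
  by rewrite !GRing.addrK.
have : (Posz y.1 + a, Posz y.2 + b)%R \in
    [fset (Posz x.1 + a, Posz x.2 + b)%R | x in s].
  by apply/imfsetP; exists y.
rewrite e => /imfsetP[z /= zt [e1 e2]]; exists z => //.
by rewrite -e1 -e2 !GRing.addrK.
Qed.

Lemma translates_trans (s t u : squares) :
  translates s t -> translates t u -> translates s u.
Proof.
move=> [a [b e]] [a' [b' e']]; exists (a + a')%R, (b + b')%R.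
rewrite -e'; apply/fsetP=> x; apply/imfsetP/imfsetP => /= [[y ys ->]|[y yt ->]].
  have : (Posz y.1 + a, Posz y.2 + b)%R \in
      [fset (Posz x.1 + a, Posz x.2 + b)%R | x in s].
    by apply/imfsetP; exists y.
  rewrite e => /imfsetP[z /= zt [e1 e2]]; exists z => //.
  by rewrite -e1 -e2 !GRing.addrA.
have : (Posz y.1, Posz y.2) \in [fset (Posz x.1, Posz x.2) | x in t].
  by apply/imfsetP; exists y.
rewrite -e => /imfsetP[z /= zs [-> ->]]; exists z => //.
by rewrite !GRing.addrA.
Qed.

Lemma iso_sym (s t : squares) : iso s t -> iso t s.
Proof.
case=> f [[g fK gK] ft]; exists g; split; first by exists f.
by move=> c; rewrite -{1}(gK c); apply: translates_sym.
Qed.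

Lemma iso_trans (s t u : squares) : iso s t -> iso t u -> iso s u.
Proof.
move=> [f [bf ft]] [g [bg gt]]; exists (g \o f); split; first exact: bij_comp.
by move=> c; apply: translates_trans (ft c) (gt _).
Qed.

Lemma iso_dclass (s t : squares) : iso s t -> dclass s = dclass t.
Proof.
move=> st; apply/seteqP; split=> u [su iu]; split=> //.
  exact: iso_trans (iso_sym st) iu.
exact: iso_trans st iu.
Qed.

Lemma translates_iso (s t : squares) :
  connected s -> connected t -> translates s t -> iso s t.
Proof.
move=> cs ct st; rewrite /iso !components_connected //.
exists (fun=> [` fset11 t]); split=> [|c].
  by exists (fun=> [` fset11 s]) => c; apply/val_inj/esym/fset1P/valP.
by have /fset1P -> := valP c.
Qed.

Let near (k : nat) (x y : nat * nat) : bool :=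
  [&& y.1 <= x.1 + k, x.1 <= y.1 + k, y.2 <= x.2 + k & x.2 <= y.2 + k].

Let adj_near (k : nat) (x y z : nat * nat) :
  adj x y -> near k y z -> near k.+1 x z.
Proof.
rewrite /near /adj; case: x y z => [a b] [a' b'] [a2 b2] /=.
by move=> h /and4P[h1 h2 h3 h4]; lia.
Qed.

Let path_near (s : squares) (x : s) (p : seq s) :
  path [rel u v : s | adj (val u) (val v)] x p ->
  near (size p) (val x) (val (last x p)).
Proof.
elim: p x => [|y p IH] x /=; first by rewrite /near !addn0 !leqnn.
by move=> /andP[axy /IH]; apply: adj_near.
Qed.

Let connected_near (s : squares) (x y : nat * nat) :
  connected s -> x \in s -> y \in s -> near #|` s| x y.
Proof.
move=> [_ cs] xs ys; have /connectP[p] := cs [` xs] [` ys].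
move=> /shortenP[p' pp' up' _] e.
have le_p : size p' <= #|` s|.
  by apply: ltnW; have := max_card (mem ([` xs] :: p'));
    rewrite cardfE (card_uniqP up').
have := path_near pp'; rewrite -e /= /near => /and4P[h1 h2 h3 h4].
by apply/and4P; split; [move: h1|move: h2|move: h3|move: h4];
  move/leq_trans; apply; rewrite leq_add2l.
Qed.

(* The set s moved so that its square x comes to (d, d). *)
Let centered (d : nat) (s : squares) (x : nat * nat) : squares :=
  [fset (y.1 + d - x.1, y.2 + d - x.2) | y in s].

Let moved (d : nat) (s : squares) (x y : nat * nat) :
  connected s -> #|` s| <= d -> x \in s -> y \in s ->
  (Posz y.1 + (Posz d - Posz x.1), Posz y.2 + (Posz d - Posz x.2))%R =
  (Posz (y.1 + d - x.1), Posz (y.2 + d - x.2)).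
Proof.
move=> cs sd xs ys; have /and4P[_ h1 _ h2] := connected_near cs xs ys.
have sub (a b : nat) : a <= b + #|` s| ->
    (Posz b + (Posz d - Posz a))%R = Posz (b + d - a).
  by move=> h; have := leq_trans h (leq_add (leqnn b) sd); lia.
by congr pair; apply: sub.
Qed.

Let centered_translates (d : nat) (s : squares) (x : nat * nat) :
  connected s -> #|` s| <= d -> x \in s -> translates s (centered d s x).
Proof.
move=> cs sd xs; exists (Posz d - Posz x.1)%R, (Posz d - Posz x.2)%R.
apply/fsetP=> z; apply/imfsetP/imfsetP => /= [[y ys ->]|[y /imfsetP[u /= us ->] ->]].
  exists (y.1 + d - x.1, y.2 + d - x.2); first by apply/imfsetP; exists y.
  by rewrite (moved cs sd xs ys).
by exists u => //; rewrite (moved cs sd xs us).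
Qed.

Lemma bs_classes_finite (d : nat) : finite_set (bs_classes d).
Proof.
pose box : squares := [fset x in [seq (i, j) | i <- iota 0 d.*2.+1, j <- iota 0 d.*2.+1]].
pose good c := [set s | [/\ connected s, #|` s| <= d &
                          exists2 x, x \in s & centered d s x = c]]%classic.
pose F c := dclass (xget fset0 (good c)).
apply: (@sub_finite_set _ _ (F @` [set` fpowerset box])%classic); last first.
  exact/finite_image/finite_fset.
move=> D [s [[_ cs _] /andP[_ sd] ->]].
have [s0|[x xs]] := fset_0Vmem s; first by case: cs.
have gs : good (centered d s x) s by split=> //; exists x.
exists (centered d s x).
  rewrite /= fpowersetE; apply/fsubsetP=> z /imfsetP[y /= ys ->].
  rewrite in_fset; apply/allpairsP.
  have /and4P[h1 h2 h3 h4] := connected_near cs xs ys.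
  exists (y.1 + d - x.1, y.2 + d - x.2); split=> //; rewrite mem_iota /=.
    by move: (leq_trans h1 (leq_add (leqnn _) sd));
      case: x y {xs ys gs h1 h2 h3 h4} => [a b] [a' b'] /=; lia.
  by move: (leq_trans h3 (leq_add (leqnn _) sd));
    case: x y {xs ys gs h1 h2 h3 h4} => [a b] [a' b'] /=; lia.
rewrite /F; have [ct td [y yt e]] := xgetPex fset0 (ex_intro _ s gs).
apply/iso_dclass/translates_iso => //.
apply: (translates_trans (centered_translates ct td yt)); rewrite e.
exact/translates_sym/centered_translates.
Qed.

(* Indexes the variables t_B. *)
Definition bs_vars (d : nat) : {fset set squares} := fset_set (bs_classes d).

Definition removals (la : part) (D : set squares) : set part :=
  [set al | subpart al la /\ D (skew la al)]%classic.

Lemma mem_diagram (la : seq nat) (i j : nat) :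
  ((i.+1, j.+1) \in diagram la) = (j < nth 0 la i).
Proof.
rewrite in_fset; apply/allpairsPdep/idP => /= [[i' [j' [+ + [e1 e2]]]]|h].
  by rewrite -{}e1 -{}e2 !mem_iota /=; lia.
exists i.+1, j.+1; rewrite !mem_iota /=; split=> //.
have [|h'] := ltnP i (size la); first by lia.
by move: h; rewrite nth_default.
Qed.

Lemma diagram_inj : injective (fun la : part => diagram la).
Proof.
move=> [s /= hs] [t /= ht] e; apply: val_inj => /=.
have en i : nth 0 s i = nth 0 t i.
  apply/eqP; rewrite eqn_leq; apply/andP; split; rewrite leqNgt; apply/negP.
    by rewrite -mem_diagram e mem_diagram ltnn.
  by rewrite -mem_diagram -e mem_diagram ltnn.
have sz u v : is_part u -> (forall i, nth 0 u i = nth 0 v i) -> size u <= size v.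
  move=> /andP[_ u0] euv; rewrite leqNgt; apply/negP=> lt.
  by move: u0; rewrite -(nth_default 0 (leqnn (size v))) -euv mem_nth.
apply: (@eq_from_nth _ 0) => //; apply/eqP; rewrite eqn_leq.
by rewrite !sz.
Qed.

Lemma removals_finite (la : part) (D : set squares) :
  finite_set (removals la D).
Proof.
pose F c := xget la [set al : part | diagram al = c]%classic.
apply: (@sub_finite_set _ _ (F @` [set` fpowerset (diagram la)])%classic); last first.
  exact/finite_image/finite_fset.
move=> al [sal _]; exists (diagram al); first by rewrite /= fpowersetE.
by rewrite /F; apply: xget_unique => // be /diagram_inj.
Qed.

Definition rnum (la : part) (D : set squares) : nat :=
  #|` fset_set (removals la D)|.

End Diagrams.

(* Main.v *)
Require Import Defs.
From mathcomp Require Import all_boot all_order all_algebra all_fingroup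
  all_solvable all_field all_character.
From mathcomp Require Import finmap boolp classical_sets functions cardinality.
From mathcomp Require Import mpoly.
From mathcomp Require Import zify ring lra.

Set Implicit Arguments.
Unset Strict Implicit.
Unset Printing Implicit Defensive.

Import Order.TTheory GRing.Theory Num.Theory.
Local Open Scope ring_scope.

(** Encode a partition [la] by its beads [b = la + delta], a vector of [N]
    distinct naturals, for any [N] not less than the number of parts.

    Characters. The value [X b w] is the coefficient of x^b in the product of
    the Vandermonde determinant and the power sums of the cycles of [w]
    (Frobenius). Expanding the determinant writes [X b] as an integer
    combination of permutation characters on words of given content, the
    Jacobi-Trudi formula [X_jt]. Averages over the symmetric group become sums
    over multisets ([burnside], [group_sum_U]); for two vectors this is Cauchy's
    determinant identity ([U_single]), so the [X b] have norm 1. Their inner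
    product with a sign-twisted permutation character counts pairs of words,
    and an extremal argument ([extremal]) leaves only the leading term; hence
    [X b] is the irreducible character attached to [la] ([chiE]).

    Kronecker coefficients. Only the third character is expanded by
    Jacobi-Trudi, which writes g(la, la, (n - d, nu)) as a combination of
    coefficients [U n t b b], where [t] consists of one large entry depending
    on [n] and of lower entries that do not depend on [n] ([jt_low]) and have
    sum at most [d].
    Newton's identity removes the lower entries, at the price of power sums:
    what remains is a combination, with constants independent of [n], [la] and
    [N], of the numbers [G rho b b] with [rho] of sum at most [d]
    ([U_power_sums]).

    Moves of beads. The number [G rho b b] applies to the determinant that
    pairs [b] with itself the operators moving one bead down by [m], and then
    those moving one bead up by [m], for the parts [m] of [rho] ([G_dLs]). Such
    operators are derivations, so that commutators of them are operators of the
    same kind, attached to words in three letters: a step down, a step up, and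
    the projection [Pr] on the positions of beads. Next to the determinant, an
    operator whose word starts with [Pr] acts as the scalar tr([Pr :: w])
    ([T_trace]), while at the other end the letter [Pr] may be inserted freely
    ([T_first]). Commuting words across the list therefore expresses everything
    as a polynomial in traces of words ([polynomial_T]).

    Traces. The trace of a word is 0 unless its steps down and up balance; then
    it counts the positions at which all the beads required by the word are
    present. Counting the failures by their first hole
    gives [N] minus a constant minus the number of pairs made of a bead [y] and
    a hole [y - M], [M] at most [d], with a condition on the beads in between
    ([trace_word]). Such pairs are the removable border strips of size [M]
    ([hook_moved], [border_strip_ribbon]), and the beads in between are read off
    from the shape of the strip ([translates_move]). So a trace is an affine
    combination of [N] and the numbers r_la(B) with |B| at most [d]
    ([hook_count_classes], [polynomial_trace]).

    The number [N] is auxiliary: for fixed [la] the resulting polynomial in [N]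
    is constant for large [N], so that it may be evaluated at [N = 0]
    ([poly_eventually_const]). *)

(** * Sums of distinct naturals *)

Lemma exists_ge_size (s : seq nat) :
  uniq s -> (0 < size s)%N -> exists2 x : nat, x \in s & ((size s).-1 <= x)%N.
Proof.
move=> us sz; apply/hasP/negPn/negP => /hasPn h.
have sub : {subset s <= iota 0 (size s).-1}.
  by move=> x /h; rewrite mem_iota -ltnNge.
have := uniq_leq_size us sub; rewrite size_iota.
by case: (size s) sz => //= k _; rewrite ltnn.
Qed.

(** Among [k] distinct naturals one is at least [k - 1]; removing it reduces
    [k] and costs at least what [iota 0 k] loses with its last element. *)
Lemma sumn_uniq_min (s : seq nat) : uniq s ->
  (sumn (iota 0 (size s)) <= sumn s)%N /\
  (sumn s = sumn (iota 0 (size s)) -> s =i iota 0 (size s)).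
Proof.
have [m] := ubnP (size s); elim: m s => // m IH s le us.
case: (posnP (size s)) => [/size0nil -> //|s0].
have [x xs hx] := exists_ge_size us s0.
have := IH (rem x s); rewrite size_rem // rem_uniq //.
case=> [|//|ih1 ih2]; first by rewrite -ltnS (ltn_predK s0).
have es : sumn s = (x + sumn (rem x s))%N by rewrite (perm_sumn (perm_to_rem xs)).
have ei : sumn (iota 0 (size s)) = (sumn (iota 0 (size s).-1) + (size s).-1)%N.
  by rewrite -{1}(prednK s0) -addn1 iotaD cats1 sumn_rcons add0n.
rewrite es ei; split; first by rewrite addnC leq_add.
move=> e.
have xe : x = (size s).-1.
  apply/eqP; rewrite eqn_leq hx andbT -(leq_add2r (sumn (rem x s))) e.
  by rewrite addnC leq_add2l.
move: e; rewrite {1}xe addnC => /addIn e.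
move=> y; rewrite (perm_mem (perm_to_rem xs)) in_cons (ih2 e) xe !mem_iota.
by case: (size s) s0 => // k _; lia.
Qed.

(** * Words, contents and Burnside's count *)

Section Words.
Variables (n : nat) (Z : finType).
Implicit Types (v : {ffun 'I_n -> Z}) (w : 'S_n) (a : {ffun Z -> nat}).

Definition fixes w v := [forall t, v (w t) == v t].

Definition content v : {ffun Z -> nat} := [ffun z => #|[set t | v t == z]|].

Lemma fixesP w v : reflect (forall t, v (w t) = v t) (fixes w v).
Proof. exact: eqfunP. Qed.

Lemma sum_content v (P : pred Z) :
  \sum_(z | P z) content v z = #|[set t | P (v t)]|.
Proof.
rewrite -sum1_card (partition_big v P) => [|t]; last by rewrite inE.
apply: eq_bigr => z Pz; rewrite ffunE -sum1_card; apply: eq_bigl => t.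
by rewrite !inE; case: eqP => [->|]; rewrite ?Pz ?andbF.
Qed.

Lemma sum_content_word (R : nmodType) (F : Z -> R) v :
  \sum_z F z *+ content v z = \sum_t F (v t).
Proof.
rewrite [RHS](partition_big v xpredT) //=; apply: eq_bigr => z _.
rewrite (eq_bigr (fun=> F z)) => [|t /eqP-> //].
by rewrite sumr_const ffunE; congr (_ *+ _); apply: eq_card => t; rewrite !inE.
Qed.

Lemma sum_content_n v : \sum_z content v z = n.
Proof.
rewrite sum_content -[RHS]card_ord -cardsT.
by apply: eq_card => t; rewrite !inE.
Qed.

Lemma content_perm v v' : content v = content v' ->
  exists w : 'S_n, forall t, v' t = v (w t).
Proof.
move=> e; have : perm_eq [tuple v' t | t < n] [tuple v t | t < n].
  apply/allP => z _ /=; apply/eqP.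
  have cz (u : {ffun _}) : count_mem z [tuple u t | t < n] = content u z.
    rewrite /= count_map ffunE -sum1_count -[tval _]/(val (ord_tuple n)).
    rewrite val_ord_tuple big_enum_cond -sum1_card.
    by apply: eq_bigl => t; rewrite !inE.
  by rewrite !cz e.
move/tuple_permP => [w /val_inj ew]; exists w => t.
by have := congr1 (fun s => tnth s t) ew; rewrite !tnth_mktuple.
Qed.

Lemma content_surj a : \sum_z a z = n -> exists v, content v = a.
Proof.
move=> sa; pose s := flatten [seq nseq (a z) z | z <- enum Z].
have ss : size s == n.
  rewrite size_flatten /shape -map_comp -sa sumnE big_map big_enum /=.
  by apply/eqP/eq_bigr => z _; rewrite size_nseq.
exists [ffun t => tnth (Tuple ss) t]; apply/ffunP => z; rewrite ffunE.
have -> : #|[set t | [ffun t => tnth (Tuple ss) t] t == z]| = count_mem z s.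
  rewrite -[s in RHS]/(tval (Tuple ss)) -[in RHS](map_tnth_enum (Tuple ss)) count_map.
  rewrite -sum1_count big_enum_cond -sum1_card.
  by apply: eq_bigl => t; rewrite !inE ffunE.
rewrite count_flatten -map_comp sumnE big_map big_enum /= (bigD1 z) //=.
rewrite count_nseq /= eqxx mul1n big1 ?addn0 // => y yz.
by rewrite count_nseq /= (negPf yz).
Qed.

(** The permutations [g] with [v0 o g = v] form a coset of the stabilizer of
    [v], and these cosets partition the symmetric group. *)
Lemma sum_card_stab v0 :
  (\sum_(v | content v == content v0) #|[set w | fixes w v]| = n`!)%N.
Proof.
rewrite -[RHS](card_Sn n) -sum1_card.
rewrite (partition_big (fun g : 'S_n => [ffun t => v0 (g t)])
          (fun v => content v == content v0)) /=; last first.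
  move=> g _; apply/eqP/ffunP => z; rewrite !ffunE.
  rewrite -[RHS](card_preimset _ (@perm_inj _ g)); apply: eq_card => t.
  by rewrite !inE ffunE.
apply: eq_bigr => v /eqP/esym/content_perm[g eg].
rewrite sum1_card -[LHS](card_imset _ (@mulIg _ g)); apply: eq_card => h.
rewrite unfold_in -[X in _ = X]/([ffun t => v0 (h t)] == v).
apply/imsetP/eqP => [[w + ->]|/ffunP eh].
  by rewrite inE => /fixesP fw; apply/ffunP => t; rewrite ffunE permM -eg fw.
exists (h * g^-1)%g; last by rewrite mulgKV.
rewrite inE; apply/fixesP => t.
by rewrite eg -permM mulgKV -eh ffunE.
Qed.

Definition mult (L : nat) (M : {ffun Z -> 'I_L}) : {ffun Z -> nat} :=
  [ffun z => M z : nat].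

(** The contents are the orbits of words under permutation of the places; by
    orbit counting each of them contributes [n!] times its value. *)
Lemma burnside (R : pzSemiRingType) (phi : {ffun Z -> nat} -> R) :
  \sum_(w : 'S_n) \sum_(v | fixes w v) phi (content v) =
  n`!%:R * \sum_(M : {ffun Z -> 'I_n.+1} | \sum_z mult M z == n) phi (mult M).
Proof.
rewrite (exchange_big_dep xpredT) //=.
rewrite (eq_bigr (fun v => #|[set w | fixes w v]|%:R * phi (content v))); last first.
  move=> v _; rewrite sumr_const mulr_natl; congr (_ *+ _).
  by apply: eq_card => w; rewrite !inE.
have cle v z : (content v z < n.+1)%N.
  by rewrite ltnS ffunE -[leqRHS]card_ord max_card.
pose cM v : {ffun Z -> 'I_n.+1} := [ffun z => Ordinal (cle v z)].
have mcM v : mult (cM v) = content v by apply/ffunP => z; rewrite !ffunE.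
rewrite (partition_big cM (fun M => \sum_z mult M z == n)) /=; last first.
  by move=> v _; rewrite mcM sum_content_n.
rewrite mulr_sumr; apply: eq_bigr => M /eqP /content_surj[v0 e0].
rewrite -(sum_card_stab v0) natr_sum mulr_suml; apply: eq_big => v.
  rewrite e0; apply/eqP/eqP => [<-|e]; first by rewrite mcM.
  apply/ffunP => z; apply: val_inj.
  by move: e => /(congr1 (fun f : {ffun Z -> nat} => f z)); rewrite -mcM /mult !ffunE.
by move=> /eqP <-; rewrite mcM.
Qed.

End Words.

(** * Newton's identity for multisets *)

Section Newton.
Variables (n : nat) (Z : finType) (R : pzSemiRingType).
Implicit Types (a : {ffun Z -> nat}) (phi : {ffun Z -> nat} -> R).

Definition addm a (m : nat) (z : Z) : {ffun Z -> nat} :=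
  [ffun y => (a y + (y == z) * m)%N].

Lemma sum_shift_mult phi (m : nat) (z : Z) :
  (forall a y, (n < a y)%N -> phi a = 0) ->
  \sum_(M : {ffun Z -> 'I_n.+1} | (m <= M z)%N) phi (mult M) =
  \sum_(M : {ffun Z -> 'I_n.+1}) phi (addm (mult M) m z).
Proof.
move=> phi0.
pose inc (M : {ffun Z -> 'I_n.+1}) : {ffun Z -> 'I_n.+1} :=
  [ffun y => inord (M y + (y == z) * m)].
pose dec (M : {ffun Z -> 'I_n.+1}) : {ffun Z -> 'I_n.+1} :=
  [ffun y => inord (M y - (y == z) * m)].
rewrite (reindex_onto inc dec) /=; last first.
  move=> M hM; apply/ffunP => y; apply: val_inj; rewrite !ffunE /=.
  have lt := ltn_ord (M y).
  rewrite (inordK (m := (M y - (y == z) * m)%N)); last exact: leq_ltn_trans (leq_subr _ _) lt.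
  rewrite subnK ?inordK //.
  by case: eqP => [->|_]; rewrite ?mul1n.
rewrite big_mkcond; apply: eq_bigr => M _.
have [le|gt] := leqP (M z + m)%N n; last first.
  rewrite [RHS](phi0 _ z) ?ffunE ?eqxx ?mul1n //.
  case: ifP => // /andP[+ /eqP/ffunP/(_ z)/(congr1 val)].
  rewrite ffunE /= ffunE eqxx mul1n; set k := inord _ => le.
  rewrite inordK ?ffunE; last by rewrite (leq_ltn_trans (leq_subr _ _)).
  by rewrite ?eqxx ?mul1n => e; have := ltn_ord k; move: le gt; rewrite -e; lia.
have em y : (M y + (y == z) * m < n.+1)%N.
  by have := ltn_ord (M y); case: eqP => [->|_]; lia.
have -> : ((m <= inc M z)%N && (dec (inc M) == M)).
  rewrite ffunE inordK // eqxx mul1n leq_addl /=; apply/eqP/ffunP => y.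
  by apply: val_inj; rewrite !ffunE /= (inordK (em y)) addnK inordK.
by congr phi; apply/ffunP => y; rewrite !ffunE inordK.
Qed.

(** An element of multiplicity [k] may be deleted [1], [2], ..., or [k] times,
    which accounts for the factor [k]. *)
Lemma newton_mult phi (A : pred Z) :
  (forall a y, (n < a y)%N -> phi a = 0) ->
  \sum_(M : {ffun Z -> 'I_n.+1}) phi (mult M) *+ \sum_(z | A z) mult M z =
  \sum_(i < n.+1) \sum_(z | A z)
     \sum_(M : {ffun Z -> 'I_n.+1}) phi (addm (mult M) i.+1 z).
Proof.
move=> phi0; rewrite [RHS]exchange_big /=.
under [RHS]eq_bigr => z _ do under eq_bigr => i _ do rewrite -sum_shift_mult //.
transitivity (\sum_(M : {ffun Z -> 'I_n.+1}) \sum_(z | A z) phi (mult M) *+ M z).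
  by apply: eq_bigr => M _; rewrite -sumrMnr; under eq_bigr => z _ do rewrite ffunE.
rewrite exchange_big; apply: eq_bigr => z _ /=.
rewrite (exchange_big_dep xpredT) //=; apply: eq_bigr => M _.
rewrite -(big_ord_widen_cond _ xpredT (fun=> phi (mult M))); last exact: ltnW.
by rewrite sumr_const card_ord.
Qed.

End Newton.

(** * Frobenius' formula for the characters *)

Section Frobenius.
Variable N : nat.
Implicit Types (b g : 'rV[int]_N).

Definition delta : 'rV[int]_N := \row_i (rev_ord i : nat)%:Z.

Definition unitv (m : nat) (x : 'I_N) : 'rV[int]_N := \row_i (m * (i == x))%N%:Z.

Definition cvec (a : {ffun 'I_N -> nat}) : 'rV[int]_N := \row_i (a i)%:Z.

(** The coefficient of x^b in the determinant with entries x_i^(g_j); for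
    [g = delta] it is the Vandermonde determinant. *)
Definition D0 b g : rat := \det (\matrix_(i, j) (b 0 i == g 0 j)%:R).

Section Fixed_n.
Variable n : nat.

(** Frobenius' formula: the words fixed by [w] have as generating function the
    product of the power sums attached to the cycles of [w], so that [X b w] is
    the coefficient of x^b in that product times the Vandermonde determinant. *)
Definition X b (w : 'S_n) : rat :=
  \sum_(f : {ffun 'I_n -> 'I_N} | fixes w f) D0 (b - cvec (content f)) delta.

(** The permutation character of the symmetric group on words of content [t]. *)
Definition xi (r : nat) (t : {ffun 'I_r -> nat}) (w : 'S_n) : rat :=
  \sum_(f : {ffun 'I_n -> 'I_r} | fixes w f) (content f == t)%:R.

End Fixed_n.

Section U.
Variable r : nat.
Let Z := ('I_N * 'I_N * 'I_r)%type.
Implicit Types (a : {ffun Z -> nat}) (t : {ffun 'I_r -> nat}).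

Definition rowc a : {ffun 'I_N -> nat} := [ffun i => \sum_(z | z.1.1 == i) a z]%N.
Definition colc a : {ffun 'I_N -> nat} := [ffun i => \sum_(z | z.1.2 == i) a z]%N.
Definition layc a : {ffun 'I_r -> nat} := [ffun l => \sum_(z | z.2 == l) a z]%N.

Definition phiU t b g a : rat :=
  D0 (b - cvec (rowc a)) delta * D0 (g - cvec (colc a)) delta * (layc a == t)%:R.

(** The coefficient of x^b y^g z^t in
    Delta(x) Delta(y) prod_(i, j, l) 1 / (1 - x_i y_j z_l), where Delta is the
    Vandermonde determinant: a multiset of triples is a monomial of the product.
    The bound [n] on the multiplicities makes the sum finite. *)
Definition U (n : nat) t b g : rat :=
  \sum_(M : {ffun Z -> 'I_n.+1}) phiU t b g (mult M).

Definition subm t (m : nat) (l : 'I_r) : {ffun 'I_r -> nat} :=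
  [ffun k => (t k - (k == l) * m)%N].

Lemma sum_layc a : (\sum_l layc a l = \sum_z a z)%N.
Proof.
rewrite [RHS](partition_big (fun z : Z => z.2) xpredT) //=.
by apply: eq_bigr => l _; rewrite ffunE.
Qed.

(** Three words fixed by [w] are one word of triples fixed by [w]. *)
Lemma group_sum_U (n : nat) t b g : (\sum_l t l = n)%N ->
  \sum_(w : 'S_n) X b w * X g w * xi t w = n`!%:R * U n t b g.
Proof.
move=> st; pose word T := {ffun 'I_n -> T}.
pose split (v : word Z) : word 'I_N * word 'I_N * word 'I_r :=
  ([ffun t => (v t).1.1], [ffun t => (v t).1.2], [ffun t => (v t).2]).
pose join (p : word 'I_N * word 'I_N * word 'I_r) : word Z :=
  [ffun t => (p.1.1 t, p.1.2 t, p.2 t)].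
have splitK : cancel split join.
  by move=> v; apply/ffunP => s; rewrite !ffunE; case: (v s) => [[]].
have joinK : cancel join split.
  by move=> [[f1 f2] f3]; rewrite /split; congr (_, _, _); apply/ffunP => s; rewrite !ffunE.
rewrite (eq_bigr (fun w => \sum_(v : word Z | fixes w v) phiU t b g (content v))); last first.
  move=> w _; rewrite [RHS](reindex join) /=; last by exists split => p _; rewrite ?joinK ?splitK.
  rewrite /X /xi big_distrlr /= pair_big big_distrlr /= pair_big /=.
  apply: eq_big => [[[f1 f2] f3]|[[f1 f2] f3] _] /=.
    apply/andP/fixesP => [[/andP[/fixesP h1 /fixesP h2] /fixesP h3] s|h].
      by rewrite !ffunE /= h1 h2 h3.
    split; first (apply/andP; split); apply/fixesP => s; have := h s; rewrite !ffunE /=;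
      by case.
  set v := join _.
  have -> : content f1 = rowc (content v).
    by apply/ffunP => i; rewrite !ffunE sum_content; apply: eq_card => s; rewrite !inE ffunE.
  have -> : content f2 = colc (content v).
    by apply/ffunP => i; rewrite !ffunE sum_content; apply: eq_card => s; rewrite !inE ffunE.
  have -> // : content f3 = layc (content v).
  by apply/ffunP => i; rewrite !ffunE sum_content; apply: eq_card => s; rewrite !inE ffunE.
rewrite burnside; congr (_ * _); rewrite /U big_mkcond; apply: eq_bigr => M _.
case: ifPn => // ne; rewrite /phiU; case: eqP; rewrite ?mulr0 // => e.
by case/eqP: ne; rewrite -sum_layc e.
Qed.

Lemma sum_addm a m z (P : pred Z) :
  (\sum_(y | P y) addm a m z y = \sum_(y | P y) a y + P z * m)%N.
Proof.
under eq_bigr => y _ do rewrite ffunE.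
rewrite big_split /=; congr addn.
have [Pz|nPz] := boolP (P z).
  rewrite (bigD1 z) //= eqxx mul1n big1 ?addn0 ?mul1n // => y /andP[_ /negPf->].
  exact: mul0n.
rewrite big1 ?mul0n // => y Py; case: eqP Py => [->|//].
by rewrite (negPf nPz).
Qed.

(** Deleting copies of a triple [(x, y, l)] from a multiset lowers its three
    contents in the places [x], [y] and [l], so that Newton's identity is a
    recursion between coefficients, reducing [t l]. *)
Lemma U_newton (n : nat) t b g (l : 'I_r) : (\sum_k t k <= n)%N ->
  (t l)%:R * U n t b g =
  \sum_(i < t l) \sum_(x < N) \sum_(y < N)
    U n (subm t i.+1 l) (b - unitv i.+1 x) (g - unitv i.+1 y).
Proof.
move=> st.
have tl k : (t k <= n)%N by apply: leq_trans st; rewrite (bigD1 k) //= leq_addr.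
have phi0 a y : (n < a y)%N -> phiU t b g a = 0.
  move=> lt; rewrite /phiU; case: eqP; rewrite ?mulr0 // => e.
  have := st; rewrite -e sum_layc (bigD1 y) //=; lia.
transitivity (\sum_(M : {ffun Z -> 'I_n.+1})
    phiU t b g (mult M) *+ \sum_(z | z.2 == l) mult M z).
  rewrite mulr_sumr; apply: eq_bigr => M _; rewrite mulr_natl.
  rewrite /phiU; case: eqP => [<-|_]; rewrite ?mulr0 ?mul0rn //.
  by rewrite [in LHS]ffunE.
rewrite newton_mult // (big_ord_widen_cond n.+1 xpredT
  (fun i => \sum_x \sum_y U n (subm t i.+1 l) (b - unitv i.+1 x) (g - unitv i.+1 y)));
  last exact: leqW.
rewrite [RHS]big_mkcond; apply: eq_bigr => i _ /=.
have layE a z k : layc (addm a i.+1 z) k = (layc a k + (z.2 == k) * i.+1)%N.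
  by rewrite !ffunE sum_addm.
case: ifPn => [lt|ge]; last first.
  apply: big1 => z /eqP zl; apply: big1 => M _; rewrite /phiU.
  case: eqP => [e|]; rewrite ?mulr0 //.
  by move: ge; rewrite -e layE zl eqxx mul1n; lia.
rewrite [RHS]pair_big /= (reindex_onto (fun p : 'I_N * 'I_N => (p, l)) (fun z : Z => z.1)) /=;
  last by move=> [p k] /= /eqP->.
apply: eq_big => [p|[x y] _]; first by rewrite !eqxx.
rewrite /U; apply: eq_bigr => M _; rewrite /phiU.
have rowE : cvec (rowc (addm (mult M) i.+1 (x, y, l))) =
    cvec (rowc (mult M)) + unitv i.+1 x.
  by apply/rowP => k; rewrite !mxE !ffunE sum_addm /= (eq_sym k) mulnC.
have colE : cvec (colc (addm (mult M) i.+1 (x, y, l))) =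
    cvec (colc (mult M)) + unitv i.+1 y.
  by apply/rowP => k; rewrite !mxE !ffunE sum_addm /= (eq_sym k) mulnC.
rewrite rowE colE !opprD !addrA -!(addrAC _ (- unitv _ _)); congr (_ * (nat_of_bool _)%:R).
apply/idP/idP => /eqP e; apply/eqP/ffunP => k.
  by rewrite -e !ffunE sum_addm /= (eq_sym k); lia.
rewrite layE e ffunE /= (eq_sym k); case: eqP => [<-|_]; lia.
Qed.

End U.

End Frobenius.

(** * Orthogonality *)

Lemma Posz_sum (I : finType) (P : pred I) (F : I -> nat) :
  (\sum_(i | P i) F i)%N%:Z = \sum_(i | P i) (F i)%:Z.
Proof. exact: (big_morph Posz PoszD (erefl _)). Qed.

Section Orthogonality.
Variable N : nat.
Implicit Types (b g : 'rV[int]_N).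

Notation delta := (delta N).

(** The coefficient of x^b y^g in Cauchy's determinant det(1 / (1 - x_i y_j)):
    a term of the expansion carries each y_j with the same exponent, which is a
    natural, as the x_i it is matched with. *)
Definition Dp b g : rat := \det (\matrix_(i, j) ((b 0 i == g 0 j) && (0 <= g 0 j))%:R).

Lemma D0E b g :
  D0 b g = \sum_(s : 'S_N) (-1) ^+ s * [forall i, b 0 i == g 0 (s i)]%:R.
Proof.
rewrite /D0 /determinant; apply: eq_bigr => s _; congr (_ * _).
have [/forallP h|] := boolP [forall i, b 0 i == g 0 (s i)].
  by apply: big1 => i _; rewrite mxE h.
rewrite negb_forall => /existsP[i ni].
by rewrite (bigD1 i) //= mxE (negPf ni) mul0r.
Qed.

Lemma D0_sym b g : D0 b g = D0 g b.
Proof.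
rewrite /D0 -det_tr; congr (\det _).
by apply/matrixP => i j; rewrite !mxE eq_sym.
Qed.

Lemma D0_neq0 b g : D0 b g != 0 -> exists s : 'S_N, forall i, b 0 i = g 0 (s i).
Proof.
move=> nz; have [/existsP[s /eqfunP h]|] :=
  boolP [exists s : 'S_N, [forall i, b 0 i == g 0 (s i)]]; first by exists s.
rewrite negb_exists => /forallP h; case/eqP: nz; rewrite D0E big1 // => s _.
by rewrite (negPf (h s)) mulr0.
Qed.

Lemma D0_alt b g (x y : 'I_N) : x != y -> g 0 x = g 0 y -> D0 b g = 0.
Proof.
move=> xy e; rewrite D0_sym /D0; apply: (determinant_alternate xy) => k.
by rewrite !mxE e.
Qed.

Lemma D0_perm b g (s : 'S_N) : D0 b (\row_j g 0 (s j)) = (-1) ^+ s * D0 b g.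
Proof.
rewrite D0_sym [D0 b g]D0_sym -det_perm /D0 -det_mulmx; congr (\det _).
rewrite -row_permE; apply/matrixP => i j; rewrite !mxE //.
Qed.

Lemma DpE b g : Dp b g = [forall j, 0 <= g 0 j]%:R * D0 b g.
Proof.
have [/forallP h|] := boolP [forall j, 0 <= g 0 j].
  by rewrite mul1r; congr (\det _); apply/matrixP => i j; rewrite !mxE h andbT.
rewrite negb_forall mul0r => /existsP[j nj].
rewrite /Dp (expand_det_col _ j) big1 // => i _.
by rewrite mxE (negPf nj) andbF mul0r.
Qed.

Lemma sum_delta : \sum_i delta 0 i = (\sum_(i < N) i)%N%:Z.
Proof.
rewrite Posz_sum [RHS](reindex_inj rev_ord_inj) /=.
by apply: eq_bigr => i _; rewrite mxE.
Qed.

Lemma sum_distinct g : (forall j, 0 <= g 0 j) -> injective (g 0) ->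
  \sum_i delta 0 i <= \sum_i g 0 i /\
  (\sum_i g 0 i = \sum_i delta 0 i -> exists s : 'S_N, forall j, g 0 j = delta 0 (s j)).
Proof.
move=> g0 gi; pose s := [seq absz (g 0 j) | j <- enum 'I_N].
have ga j : (absz (g 0 j))%:Z = g 0 j by rewrite gez0_abs.
have us : uniq s.
  rewrite map_inj_uniq ?enum_uniq // => i j e; apply: gi.
  by rewrite -ga e ga.
have [le1 le2] := sumn_uniq_min us.
have ss : size s = N by rewrite size_map size_enum_ord.
have sg : \sum_i g 0 i = (sumn s)%:Z.
  rewrite sumnE big_map big_enum /= Posz_sum.
  by apply: eq_bigr => i _; rewrite ga.
have sd : \sum_i delta 0 i = (sumn (iota 0 (size s)))%:Z.
  by rewrite sum_delta sumnE ss -(big_mkord xpredT id) /index_iota subn0.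
rewrite sg sd; split; first by rewrite lez_nat.
move=> [] /le2; rewrite ss => mem_s.
have lt j : (absz (g 0%R j) < N)%N.
  have : absz (g 0 j) \in s by apply/map_f; rewrite mem_enum.
  by rewrite mem_s mem_iota.
have hi : injective (fun j => rev_ord (Ordinal (lt j))).
  by move=> i j /rev_ord_inj [] e; apply: gi; rewrite -ga e ga.
by exists (perm hi) => j; rewrite mxE permE rev_ordK /= ga.
Qed.

Lemma Dp_neq0 b g : Dp b g != 0 -> (forall j, 0 <= g 0 j) /\ injective (g 0).
Proof.
rewrite DpE mulf_eq0 pnatr_eq0 eqb0 negb_or negbK => /andP[/forallP h nz].
split=> // i j e; apply/eqP; apply: contraNT nz => ij.
by rewrite (D0_alt _ ij).
Qed.

(** In each term of the expansion of [D0] the entries of [b] are matched with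
    those of [g], and lowering one amounts to raising the other. *)
Lemma D0_adj b g m :
  \sum_x D0 (b - unitv m x) g = \sum_x D0 b (g + unitv m x).
Proof.
rewrite (eq_bigr (fun x => \sum_(s : 'S_N)
   (-1) ^+ s * [forall i, (b - unitv m x) 0 i == g 0 (s i)]%:R)); last first.
  by move=> x _; rewrite D0E.
rewrite [RHS](eq_bigr (fun x => \sum_(s : 'S_N)
   (-1) ^+ s * [forall i, b 0 i == (g + unitv m x) 0 (s i)]%:R)); last first.
  by move=> x _; rewrite D0E.
rewrite exchange_big [RHS]exchange_big /=; apply: eq_bigr => s _.
rewrite [RHS](reindex_inj (@perm_inj _ s)) /=; apply: eq_bigr => x _.
congr (_ * (nat_of_bool _)%:R); apply: eq_forallb => i.
by rewrite !mxE (inj_eq perm_inj) subr_eq.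
Qed.

(** Both sums move a part of the total [S] of the entries [x] and [y] of [g]
    from one to the other; together they run over all ways to write [S] as
    [t + (S - t)], except for [t = g 0 x]. Exchanging the two entries changes
    the sign of [D0], so the sum over all [t] vanishes. *)
Lemma D0_pair_sum b g (x y : 'I_N) : x != y -> (forall j, 0 <= g 0 j) ->
  \sum_(i < absz (g 0 y)) D0 b (g - unitv i.+1 y + unitv i.+1 x) +
  \sum_(i < absz (g 0 x)) D0 b (g - unitv i.+1 x + unitv i.+1 y) = - D0 b g.
Proof.
move=> xy g0; set a := absz (g 0 x); set c := absz (g 0 y).
have ga : a%:Z = g 0 x by rewrite gez0_abs.
have gc : c%:Z = g 0 y by rewrite gez0_abs.
pose u (t : nat) : 'rV[int]_N := \row_k
  (if k == x then t%:Z else if k == y then (a + c)%:Z - t%:Z else g 0 k).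
have yx : (y == x) = false by rewrite eq_sym (negPf xy).
have u1 i : g - unitv i.+1 y + unitv i.+1 x = u (a + i.+1)%N.
  apply/rowP => k; rewrite !mxE.
  have [->|kx] := eqVneq k x; first by rewrite (negPf xy) -ga; lia.
  by have [->|ky] := eqVneq k y; rewrite -?gc ?(muln0, subr0, addr0) //; lia.
have u2 i : (i < a)%N -> g - unitv i.+1 x + unitv i.+1 y = u (a - i.+1)%N.
  move=> ia; apply/rowP => k; rewrite !mxE.
  have [->|kx] := eqVneq k x; first by rewrite (negPf xy) -ga; lia.
  by have [->|ky] := eqVneq k y; rewrite -?gc ?(muln0, subr0, addr0) //; lia.
have u3 : g = u a.
  apply/rowP => k; rewrite !mxE.
  have [->|kx] := eqVneq k x; first by rewrite -ga.
  by have [->|ky] := eqVneq k y; rewrite -?gc ?(muln0, subr0, addr0) //; lia.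
rewrite [in RHS]u3; under eq_bigr => i _ do rewrite u1.
under [X in _ + X]eq_bigr => i _ do rewrite u2 //.
apply/eqP; rewrite -subr_eq0 opprK -addrA addrC -addrA.
have anti t : (t <= a + c)%N -> D0 b (u (a + c - t)%N) = - D0 b (u t).
  move=> le; rewrite -mulN1r -[X in X * _]/((-1) ^+ true).
  have -> : true = odd_perm (tperm x y) by rewrite odd_tperm xy.
  rewrite -D0_perm; congr D0; apply/rowP => k; rewrite !mxE.
  case: tpermP => [->|->|/eqP kx /eqP ky].
  - by rewrite eqxx yx eqxx; lia.
  - by rewrite yx eqxx eqxx; lia.
  - by rewrite (negPf kx) (negPf ky).
have tot : \sum_(t < (a + c).+1) D0 b (u t) = 0.
  have e : \sum_(t < (a + c).+1) D0 b (u t) = - \sum_(t < (a + c).+1) D0 b (u t).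
    rewrite {1}(reindex_inj rev_ord_inj) /= -sumrN; apply: eq_bigr => t _.
    by rewrite subSS anti // -ltnS.
  lra.
apply/eqP; apply: etrans tot; rewrite -(big_mkord xpredT (fun t => D0 b (u t))).
rewrite (big_cat_nat (n := a)) //=; last by lia.
rewrite (big_ltn (m := a)); last by lia.
congr (_ + _); last first.
  congr (_ + _); rewrite -(big_mkord xpredT (fun i => D0 b (u (a + i.+1)%N))).
  rewrite -{1}[a.+1]add0n big_addn; have -> : ((a + c).+1 - a.+1 = c)%N by lia.
  by apply: eq_bigr => i _; congr (D0 _ (u _)); lia.
rewrite big_mkord (reindex_inj rev_ord_inj) /=; apply: eq_bigr => i _.
by congr (D0 _ (u _)); have := ltn_ord i; lia.
Qed.

Lemma sum_ord_id : (\sum_(i < N) i).*2 = (N * N.-1)%N.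
Proof.
rewrite -(big_mkord xpredT id) bin2_sum -mul2n mulnC bin2 ?muln2 halfK oddM.
by case: (N) => //= k; rewrite andNb subn0.
Qed.

Lemma sum_unitv g m x : \sum_i (g - unitv m x) 0 i = \sum_i g 0 i - m%:Z.
Proof.
rewrite (eq_bigr (fun i => g 0 i - unitv m x 0 i)); last by move=> i _; rewrite !mxE.
rewrite sumrB; congr (_ - _).
rewrite (bigD1 x) //= big1 ?addr0 ?mxE ?eqxx ?muln1 //.
by move=> i ne; rewrite mxE (negPf ne) muln0.
Qed.

(** Cauchy's determinant satisfies Newton's recursion too. The terms with
    [x = y] contribute the sum of the entries of [g] times [D0 b g], and by
    [D0_pair_sum] each of the [N (N - 1) / 2] pairs [x != y] contributes
    [- D0 b g]; the difference of the two factors is [m]. *)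
Lemma Dp_newton b g (m : nat) : \sum_i g 0 i = \sum_i delta 0 i + m%:Z ->
  m%:R * Dp b g =
  \sum_(i < m) \sum_x \sum_y Dp (b - unitv i.+1 x) (g - unitv i.+1 y).
Proof.
move=> sg.
pose T i y := \sum_x Dp (b - unitv i.+1 x) (g - unitv i.+1 y).
transitivity (\sum_y \sum_(i < m) T i y); last first.
  by rewrite exchange_big; apply: eq_bigr => i _; rewrite exchange_big.
have [/forallP g0|] := boolP [forall j, 0 <= g 0 j]; last first.
  rewrite negb_forall => /existsP[j nj].
  rewrite DpE; case: forallP => [/(_ j)|_]; first by rewrite (negPf nj).
  rewrite mul0r mulr0 big1 // => y _; rewrite big1 // => i _.
  rewrite /T big1 // => x _; rewrite DpE.
  case: forallP => [/(_ j)|_]; rewrite ?mul0r // !mxE.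
  move=> h; case/negP: nj; apply: le_trans h _.
  by rewrite lerBlDr lerDl.
have ga j : (absz (g 0 j))%:Z = g 0 j by rewrite gez0_abs.
have TE i y : T i y = (i < absz (g 0%R y))%N%:R * \sum_x D0 b (g - unitv i.+1 y + unitv i.+1 x).
  rewrite -D0_adj mulr_sumr; apply: eq_bigr => x _; rewrite DpE.
  congr ((nat_of_bool _)%:R * _); apply/forallP/idP => [/(_ y)|h j].
    by rewrite !mxE eqxx -ga; lia.
  rewrite !mxE; case: eqP => [->|_]; last by rewrite muln0 subr0.
  by rewrite muln1 -ga subr_ge0 lez_nat.
(* the entries of [g - unitv i.+1 y] would be distinct with too small a sum *)
have T0 i y : (m <= i)%N -> T i y = 0.
  move=> mi; apply: big1 => x _; apply/eqP; apply: contraT => /Dp_neq0 [h1 h2].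
  by have [] := sum_distinct h1 h2; rewrite sum_unitv sg; lia.
pose f x y := \sum_(i < absz (g 0 y)) D0 b (g - unitv i.+1 y + unitv i.+1 x).
have step y : \sum_(i < m) T i y = \sum_x f x y.
  pose K := maxn m (absz (g 0 y)).
  transitivity (\sum_(i < K) T i y).
    rewrite (big_ord_widen K (T^~ y)) ?leq_maxl // big_mkcond; apply: eq_bigr => i _.
    by case: ltnP => // /T0.
  rewrite /f [RHS]exchange_big /= [RHS](big_ord_widen K
    (fun i => \sum_x D0 b (g - unitv i.+1 y + unitv i.+1 x))) ?leq_maxr //.
  rewrite [RHS]big_mkcond; apply: eq_bigr => i _; rewrite TE.
  by case: ltnP; rewrite ?mul1r ?mul0r.
under eq_bigr => y _ do rewrite step.
have -> : Dp b g = D0 b g by rewrite DpE (introT forallP g0) mul1r.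
have f_diag y : f y y = (absz (g 0 y))%:R * D0 b g.
  rewrite /f (eq_bigr (fun=> D0 b g)) => [|i _]; last by rewrite subrK.
  by rewrite sumr_const card_ord mulr_natl.
have dbl : 2 * (\sum_y \sum_x f x y) = \sum_y \sum_x (f x y + f y x).
  rewrite mulr2n mulrDl mul1r {2}exchange_big /= -big_split /=.
  by apply: eq_bigr => y _; rewrite big_split.
suff : 2 * (\sum_y \sum_x f x y) = 2 * (m%:R * D0 b g) by lra.
rewrite dbl (eq_bigr (fun y => (2 * (absz (g 0 y))%:R - N.-1%:R) * D0 b g)); last first.
  move=> y _; rewrite (bigD1 y) //= f_diag.
  rewrite (eq_bigr (fun=> - D0 b g)) => [|x xy]; last by rewrite D0_pair_sum.
  by rewrite sumr_const cardC1 card_ord -mulr_natl; ring.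
rewrite -mulr_suml mulrA; congr (_ * _); rewrite sumrB -mulr_sumr.
rewrite sumr_const card_ord -[N.-1%:R *+ N]mulr_natl -natrM -sum_ord_id -mul2n natrM -mulrBr.
congr (_ * _); have : (\sum_i absz (g 0%R i) = \sum_(i < N) i + m)%N.
  apply/eqP; rewrite -eqz_nat PoszD -sum_delta -sg Posz_sum.
  by apply/eqP/eq_bigr => i _; rewrite ga.
by move=> e; rewrite -natr_sum e natrD addrC addKr.
Qed.
End Orthogonality.

Section Norm.
Variable N : nat.
Implicit Types (b g : 'rV[int]_N).

Notation delta := (delta N).

Lemma delta_ge0 j : 0 <= delta 0 j. Proof. by rewrite mxE. Qed.

Lemma D0_delta : D0 delta delta = 1.
Proof.
rewrite /D0 -[RHS](det1 _ N); congr (\det _); apply/matrixP => i j.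
by rewrite !mxE eqz_nat (inj_eq val_inj) (inj_eq rev_ord_inj).
Qed.

Lemma D0_delta_perm (s : 'S_N) g : (forall j, g 0 j = delta 0 (s j)) ->
  D0 g delta = (-1) ^+ s.
Proof.
move=> h; have -> : g = \row_j delta 0 (s j) by apply/rowP => j; rewrite mxE h.
by rewrite D0_sym D0_perm D0_delta mulr1.
Qed.

(** Distinct naturals with the sum of [delta] are a rearrangement of [delta];
    for all other [g] both sides vanish. *)
Lemma U_base_zero b g : \sum_i g 0 i = \sum_i delta 0 i ->
  D0 b delta * D0 g delta = Dp b g.
Proof.
move=> sg; have [e|/D0_neq0[s hs]] := eqVneq (D0 g delta) 0; last first.
  rewrite (D0_delta_perm hs) DpE.
  have -> : [forall j, 0 <= g 0 j] by apply/forallP => j; rewrite hs delta_ge0.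
  have -> : g = \row_j delta 0 (s j) by apply/rowP => j; rewrite mxE hs.
  by rewrite D0_perm mul1r mulrC.
rewrite e mulr0; apply/esym/eqP; apply: contraT => /Dp_neq0[h1 h2].
have [_ /(_ sg) [s hs]] := sum_distinct h1 h2.
by have /eqP := D0_delta_perm hs; rewrite e eq_sym signr_eq0.
Qed.

Definition single (r : nat) (l : 'I_r) (m : nat) : {ffun 'I_r -> nat} :=
  [ffun k => ((k == l) * m)%N].

(** Cauchy's identity Delta(x) Delta(y) prod_(i, j) 1 / (1 - x_i y_j) =
    det(1 / (1 - x_i y_j)), coefficient by coefficient: both sides satisfy
    Newton's recursion in the degree [m] and agree in degree 0. *)
Lemma U_single (n r : nat) (l : 'I_r) (m : nat) b g : (m <= n)%N ->
  \sum_i b 0 i = \sum_i delta 0 i + m%:Z ->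
  \sum_i g 0 i = \sum_i delta 0 i + m%:Z ->
  U n (single l m) b g = Dp b g.
Proof.
have sum_single k : (\sum_i single l k i)%N = k.
  rewrite (bigD1 l) //= ffunE eqxx mul1n big1 ?addn0 // => i ne.
  by rewrite ffunE (negPf ne).
have [p] := ubnP m; elim: p => // p IH in m b g *; rewrite ltnS => mp mn sb sg.
have [m0|m0] := posnP m.
  rewrite {}m0 addr0 {sb mp mn} in sg *; rewrite -U_base_zero //.
  pose M0 : {ffun 'I_N * 'I_N * 'I_r -> 'I_n.+1} := [ffun=> ord0].
  rewrite /U (bigD1 M0) //= big1 ?addr0; last first.
    move=> M ne; rewrite /phiU; case: eqP; rewrite ?mulr0 // => /ffunP e.
    case/eqP: ne; apply/ffunP => z; apply: val_inj; rewrite ffunE /=.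
    have := e z.2; rewrite !ffunE muln0 => /eqP.
    by rewrite sum_nat_eq0 => /forallP/(_ z); rewrite eqxx ffunE => /eqP.
  have z0 (P : pred _) : (\sum_(z | P z) mult M0 z)%N = 0%N.
    by apply: big1 => z _; rewrite /mult !ffunE.
  have c0 (a : {ffun 'I_N -> nat}) : (forall i, a i = 0)%N -> cvec a = 0.
    by move=> a0; apply/rowP => i; rewrite !mxE a0.
  rewrite /phiU !c0 ?subr0; try by move=> i; rewrite ffunE z0.
  rewrite (introT eqP) ?mulr1 //; apply/ffunP => k.
  by rewrite !ffunE z0 muln0.
have := U_newton (t := single l m) b g l; rewrite sum_single => /(_ n mn).
rewrite {1}ffunE eqxx mul1n => e.
have m1 : m%:R != 0 :> rat by rewrite pnatr_eq0 -lt0n.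
apply: (mulfI m1); rewrite e (Dp_newton _ sg).
have -> : single l m l = m by rewrite ffunE eqxx mul1n.
apply: eq_bigr => i _; apply: eq_bigr => x _; apply: eq_bigr => y _.
have im := ltn_ord i.
have -> : subm (single l m) i.+1 l = single l (m - i.+1).
  by apply/ffunP => k; rewrite !ffunE mulnBr.
by rewrite IH ?sum_unitv ?sb ?sg //; lia.
Qed.

End Norm.

(** * The irreducible characters of the symmetric group *)

Section Characters.
Variable n : nat.
Local Notation Sn := [set: 'S_n].

Lemma cfdot_ratr (phi psi : 'CF(Sn)) (F G : 'S_n -> rat) :
  (forall w, phi w = ratr (F w)) -> (forall w, psi w = ratr (G w)) ->
  '[phi, psi] = ratr (n`!%:R^-1 * \sum_w F w * G w).
Proof.
move=> eF eG; rewrite cfdotE cardsT card_Sn rmorphM fmorphV rmorph_nat rmorph_sum /=.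
congr (_ * _); apply: eq_big => [w|w _]; first by rewrite inE.
by rewrite eF eG conj_Crat ?Crat_rat // rmorphM.
Qed.

Section Induced.
Variable r : nat.
Implicit Types (f : {ffun 'I_n -> 'I_r}) (t : {ffun 'I_r -> nat}).

Lemma fixes_conj (w y : 'S_n) f :
  fixes (w ^ y)%g f = fixes w [ffun k => f (y k)].
Proof.
apply/fixesP/fixesP => h k; last first.
  by have := h (y^-1 k)%g; rewrite !ffunE /conjg !permM permKV.
by have := h (y k); rewrite /conjg !permM permK !ffunE.
Qed.

Lemma content_comp (y : 'S_n) f : content [ffun k => f (y k)] = content f.
Proof.
apply/ffunP => z; rewrite !ffunE -[RHS](card_preimset _ (@perm_inj _ y)).
by apply: eq_card => k; rewrite !inE ffunE.
Qed.

(** Cosets of the stabilizer of the word [f] are words with the content of [f];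
    the formula for induced characters thus counts such words fixed by [w]. *)
Lemma Ind_level_stab (h : 'I_n -> nat) f (w : 'S_n) : (forall k, h k = f k) ->
  'Ind[Sn] (1 : 'CF(level_stab_group h)) w = ratr (xi (content f) w).
Proof.
move=> hf; rewrite cfIndE ?finset.subsetT //.
have stabE (s : 'S_n) : (s \in level_stab h) = fixes s f.
  rewrite inE; apply/forallP/fixesP => e k.
    by apply: val_inj; rewrite /= -!hf (eqP (e k)).
  by rewrite !hf e.
rewrite (eq_big predT (fun y : 'S_n => (fixes w [ffun k => f (y k)])%:R)); first last.
- by move=> y _; rewrite cfun1E /= stabE fixes_conj.
- by move=> y; rewrite inE.
rewrite (partition_big (fun y : 'S_n => [ffun k => f (y k)])
          (fun g => content g == content f)) /=; last first.
  by move=> y _; rewrite content_comp.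
rewrite (eq_bigr (fun g => #|level_stab h|%:R * (fixes w g)%:R)); last first.
  move=> g /eqP/esym/content_perm[y ey].
  rewrite (eq_bigr (fun=> (fixes w g)%:R)) => [|s /eqP-> //].
  rewrite sumr_const mulr_natl; congr (_ *+ _).
  rewrite -[RHS](card_imset _ (mulgI y)); apply: eq_card => s.
  rewrite unfold_in -[X in X = _]/([ffun k => f (s k)] == g).
  apply/eqP/imsetP => [/ffunP es|[u + ->]].
    exists (y^-1 * s)%g; last by rewrite mulKVg.
    rewrite stabE; apply/fixesP => k; rewrite permM.
    have := es (y^-1 k)%g; rewrite ffunE => ->.
    by rewrite ey permKV.
  by rewrite stabE => /fixesP fu; apply/ffunP => k; rewrite ffunE permM fu ey.
rewrite -mulr_sumr mulKf; last by rewrite pnatr_eq0 -lt0n cardG_gt0.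
rewrite /xi rmorph_sum /=.
rewrite big_mkcond [RHS]big_mkcond; apply: eq_bigr => g _.
by rewrite rmorph_nat; case: (content g == _); case: (fixes w g).
Qed.

Definition xiC t : 'CF(Sn) :=
  if [pick f : {ffun 'I_n -> 'I_r} | content f == t] is Some f
  then 'Ind[Sn] (1 : 'CF(level_stab_group (fun k => f k : nat))) else 0.

Lemma xiCE t w : xiC t w = ratr (xi t w).
Proof.
rewrite /xiC; case: pickP => [f /eqP <-|no]; first exact: Ind_level_stab.
by rewrite cfunE /xi big1 ?rmorph0 // => f _; rewrite no.
Qed.

Lemma xiC_char t : xiC t \is a character.
Proof.
rewrite /xiC; case: pickP => [f _|_]; last exact: cfun0_char.
exact/cfInd_char/cfun1_char.
Qed.

End Induced.

Section VirtualX.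
Variable N : nat.
Implicit Types (b g : 'rV[int]_N).

Notation delta := (delta N).

(** The exponents of the Jacobi-Trudi determinant. *)
Definition jt_ok b (s : 'S_N) := [forall i, delta 0 (s i) <= b 0 i].
Definition jt b (s : 'S_N) : {ffun 'I_N -> nat} :=
  [ffun i => absz (b 0%R i - delta 0%R (s i))].

(** The Jacobi-Trudi formula: a term of the Vandermonde determinant prescribes
    the content of the words that contribute to [X b w]. *)
Lemma X_jt b (w : 'S_n) :
  X b w = \sum_(s : 'S_N) (-1) ^+ s * ((jt_ok b s)%:R * xi (jt b s) w).
Proof.
rewrite /X (eq_bigr (fun f : {ffun 'I_n -> 'I_N} => \sum_(s : 'S_N)
  (-1) ^+ s * [forall i, (b - cvec (content f)) 0 i == delta 0 (s i)]%:R)); last first.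
  by move=> f _; rewrite D0E.
rewrite exchange_big; apply: eq_bigr => s _ /=; rewrite -mulr_sumr; congr (_ * _).
rewrite /xi mulr_sumr; apply: eq_bigr => f _.
rewrite -natrM mulnb; congr (nat_of_bool _)%:R.
apply/forallP/andP => [h|[/forallP ok /eqP/ffunP e] i].
  split; first by apply/forallP => i; have /eqP <- := h i; rewrite !mxE lerBlDr lerDl.
  apply/eqP/ffunP => i; rewrite [RHS]ffunE; have /eqP <- := h i.
  by rewrite !mxE subKr absz_nat.
by have := ok i; rewrite !mxE e ffunE !mxE => le; rewrite gez0_abs ?subr_ge0 // subKr.
Qed.

Definition XC b : 'CF(Sn) :=
  \sum_(s : 'S_N) (-1) ^+ s *: (if jt_ok b s then xiC (jt b s) else 0).

Lemma XCE b w : XC b w = ratr (X b w).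
Proof.
rewrite X_jt rmorph_sum sum_cfunE; apply: eq_bigr => s _; rewrite cfunE rmorphM rmorph_sign.
congr (_ * _); case: (jt_ok b s); first by rewrite mul1r xiCE.
by rewrite cfunE mul0r rmorph0.
Qed.

Lemma XC_vchar b : XC b \in 'Z[irr Sn]%g.
Proof.
apply: rpred_sum => s _; rewrite rpredZsign; case: ifP => _; last exact: rpred0.
exact/char_vchar/xiC_char.
Qed.

Lemma X_orth b g : \sum_i b 0 i = \sum_i delta 0 i + n%:Z ->
  \sum_i g 0 i = \sum_i delta 0 i + n%:Z ->
  \sum_(w : 'S_n) X b w * X g w = n`!%:R * Dp b g.
Proof.
move=> sb sg; rewrite -(@U_single N n 1 ord0 n b g) // -group_sum_U; last first.
  by rewrite big_ord1 ffunE mul1n.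
apply: eq_bigr => w _; rewrite -[LHS]mulr1; congr (_ * _).
rewrite /xi (bigD1 [ffun=> ord0]) /=; last by apply/fixesP => k; rewrite !ffunE.
rewrite big1 ?addr0 => [|f /andP[_ /eqP ne]]; last first.
  by case: ne; apply/ffunP => k; rewrite [f k]ord1 [RHS]ord1.
rewrite (introT eqP) //; apply/ffunP => k; rewrite !ord1 !ffunE mul1n.
by rewrite -[RHS]card_ord -cardsT; apply: eq_card => j; rewrite !inE ffunE.
Qed.

Lemma Dp_self b : (forall j, 0 <= b 0 j) -> injective (b 0) -> Dp b b = 1.
Proof.
move=> b0 bi; rewrite /Dp -[RHS](det1 _ N); congr (\det _); apply/matrixP => i j.
by rewrite !mxE b0 andbT (inj_eq bi).
Qed.

Lemma XC_norm b : \sum_i b 0 i = \sum_i delta 0 i + n%:Z ->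
  (forall j, 0 <= b 0 j) -> injective (b 0) -> '[XC b] = 1.
Proof.
move=> sb b0 bi; rewrite (cfdot_ratr (XCE b) (XCE b)) X_orth // Dp_self //.
by rewrite mulr1 mulVf ?rmorph1 // pnatr_eq0 -lt0n fact_gt0.
Qed.

End VirtualX.

(** Each common constituent contributes at least 1 to the inner product of two
    characters. *)
Lemma pick_constt (A B : 'CF(Sn)) (j : Iirr Sn) :
  A \is a character -> B \is a character -> '[A, B] = 1 ->
  j \in irr_constt A -> j \in irr_constt B ->
  odflt 0 [pick i | (i \in irr_constt A) && (i \in irr_constt B)] = j.
Proof.
move=> cA cB AB jA jB; case: pickP => [i /andP[iA iB]|/(_ j)]; last by rewrite jA jB.
apply/eqP; apply: contraT => ij.
have [A' cA' eA] := constt_charP i cA iA.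
have jA' : j \in irr_constt A'.
  move: jA; rewrite !irr_consttE eA cfdotDl cfdot_irr (negPf ij) add0r //.
have n1 : '['chi_i, B] \is a Num.nat by rewrite Cnat_cfdot_char ?irr_char.
have n2 : '[A', B] \is a Num.nat by rewrite Cnat_cfdot_char.
have z1 : '['chi_i, B] != 0 by rewrite cfdotC fmorph_eq0 -irr_consttE.
have z2 : '[A', B] != 0.
  apply/eqP => z; have := constt_ortho_char cA' cB jA' jB z.
  by rewrite cfdot_irr eqxx => /eqP; rewrite oner_eq0.
move: AB z1 z2; rewrite eA cfdotDl; case/natrP: n1 => k1 ->; case/natrP: n2 => k2 ->.
rewrite -natrD !pnatr_eq0 => /eqP; rewrite pnatr_eq1; lia.
Qed.

End Characters.

Lemma nth_part (la : seq nat) i j : is_part la -> (i <= j)%N ->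
  (nth 0%N la j <= nth 0%N la i)%N.
Proof.
move=> /andP[sla _] ij; have [jl|jl] := ltnP j (size la); last by rewrite nth_default.
have tr : transitive geq by move=> x y z /= h1 h2; apply: leq_trans h2 h1.
by apply: (sorted_leq_nth tr leqnn 0 sla); rewrite ?inE // (leq_ltn_trans ij).
Qed.

Lemma nth_le_sumn (la : seq nat) i : (nth 0%N la i <= sumn la)%N.
Proof.
have [h|h] := ltnP i (size la); last by rewrite nth_default.
by rewrite sumnE (big_nth 0%N) big_mkord (bigD1 (Ordinal h)) //= leq_addr.
Qed.

Definition beads (N : nat) (la : seq nat) : 'rV[int]_N :=
  \row_i (nth 0%N la i + rev_ord i)%N%:Z.

Section Beads.
Variables (N : nat) (la : seq nat).
Hypothesis hla : is_part la.

Lemma beads_ge0 j : 0 <= beads N la 0 j. Proof. by rewrite mxE. Qed.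

Lemma beads_ltn (i j : 'I_N) : (i < j)%N -> beads N la 0 j < beads N la 0 i.
Proof.
move=> ij; rewrite !mxE /= ltz_nat; have := nth_part hla (ltnW ij).
have := ltn_ord j; lia.
Qed.

Lemma beads_inj : injective (beads N la 0).
Proof.
move=> i j e; apply/val_inj/eqP; rewrite eqn_leq; apply/andP.
by split; rewrite leqNgt; apply/negP => /beads_ltn; rewrite e ltxx.
Qed.

Lemma sum_beads : (size la <= N)%N ->
  \sum_i beads N la 0 i = \sum_i delta N 0 i + (sumn la)%:Z.
Proof.
move=> sz; have -> : sumn la = (\sum_(i < N) nth 0%N la i)%N.
  rewrite sumnE (big_nth 0%N) big_mkord [LHS](big_ord_widen N (fun i => nth 0%N la i)) //.
  rewrite [LHS]big_mkcond; apply: eq_bigr => i _.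
  by case: ltnP => // h; rewrite nth_default.
rewrite Posz_sum -big_split; apply: eq_bigr => i _ /=.
by rewrite !mxE PoszD addrC.
Qed.

End Beads.

(** A repeated letter gives a transposition stabilizing the word; multiplication
    by it pairs the permutations of opposite signs. *)
Lemma sgn_stab (n : nat) (Z : finType) (v : {ffun 'I_n -> Z}) :
  \sum_(w : 'S_n | fixes w v) (-1) ^+ w = (injectiveb v)%:R :> rat.
Proof.
have [/injectiveP vi|/injectivePn[x [y xy e]]] := boolP (injectiveb v).
  rewrite (bigD1 1%g) ?odd_perm1 //=; last by apply/fixesP => t; rewrite perm1.
  rewrite big1 ?addr0 // => w /andP[/fixesP fw ne]; case/eqP: ne.
  by apply/permP => t; rewrite perm1; apply: vi.
set S := LHS; suff : S = - S by rewrite mulr0n; lra.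
rewrite /S {1}(reindex_inj (mulIg (tperm x y))) -sumrN /=; apply: eq_big => w.
  have tv t : v (tperm x y t) = v t by case: tpermP => [->|->|].
  by apply/fixesP/fixesP => h t; have := h t; rewrite permM tv.
by rewrite odd_permM odd_tperm xy addbT signrN.
Qed.

Lemma sgn_char (n : nat) : sgn_cfun n \is a character.
Proof.
have sgn_repr : mx_repr [set: 'S_n] (fun s : 'S_n => ((-1) ^+ s)%:M : 'M[algC]_1).
  split=> [|s t _ _]; first by rewrite odd_perm1.
  by rewrite odd_permM signr_addb scalar_mxM.
have -> : sgn_cfun n = cfRepr (MxRepresentation sgn_repr).
  by apply/cfun_inP => s sG; rewrite cfunE [RHS]cfunE sG mxtrace_scalar /=.
exact: cfRepr_char.
Qed.

Section Specht.
Variables (n N : nat) (la : seq nat).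
Hypotheses (hla : is_part la) (sn : sumn la = n) (sz : (size la <= N)%N).

Let b := beads N la.

Let row_lt (k : 'I_n) : (reshape_index la k < N)%N.
Proof. by rewrite (leq_trans _ sz) // reshape_indexP // sn. Qed.

Let col_lt (k : 'I_n) : (reshape_offset la k < n)%N.
Proof.
have lt : (k < sumn la)%N by rewrite sn.
apply: leq_trans (reshape_offsetP lt) _; apply: leq_trans (nth_le_sumn _ _) _.
by rewrite sn.
Qed.

Let f0 : {ffun 'I_n -> 'I_N} := [ffun k => Ordinal (row_lt k)].
Let g0 : {ffun 'I_n -> 'I_n} := [ffun k => Ordinal (col_lt k)].

Let cell_lt (k : 'I_n) : (g0 k < nth 0%N la (f0 k))%N.
Proof. by rewrite !ffunE /= reshape_offsetP // sn. Qed.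

Let cell_ex i j : (j < nth 0%N la i)%N -> exists2 k : 'I_n, f0 k = i :> nat & g0 k = j :> nat.
Proof.
move=> ji; have lt : (flatten_index la i j < n)%N by rewrite -sn flatten_indexP.
exists (Ordinal lt); rewrite ffunE /=.
  by rewrite flatten_indexKl.
by rewrite flatten_indexKr.
Qed.

Let cell_inj k k' : f0 k = f0 k' :> nat -> g0 k = g0 k' :> nat -> k = k'.
Proof.
rewrite !ffunE /= => e1 e2; apply: val_inj => /=.
by rewrite -(reshape_indexK la k) -(reshape_indexK la k') e1 e2.
Qed.

Lemma card_ord_ltn m k : (k <= m)%N -> #|[set j : 'I_m | (j < k)%N]| = k.
Proof.
move=> km; rewrite -sum1_card -[RHS]card_ord -sum1_card (big_ord_widen m (fun=> 1%N)) //.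
by apply: eq_bigl => j; rewrite inE.
Qed.

Let content_f0 i : content f0 i = nth 0%N la i.
Proof.
rewrite ffunE; have le : (nth 0%N la i <= n)%N by rewrite -sn nth_le_sumn.
rewrite -[RHS](card_ord_ltn le) -(card_in_imset (f := g0)) => [|k k']; last first.
  by rewrite !inE => /eqP ek /eqP ek' e; apply: cell_inj; rewrite ?ek ?ek' ?e.
apply: eq_card => j; rewrite inE; apply/imsetP/idP => [[k + ->]|/cell_ex[k e1 e2]].
  by rewrite inE => /eqP <-.
by exists k; [rewrite inE; apply/eqP/val_inj|apply: val_inj].
Qed.

Lemma jt_ok1 : jt_ok b 1.
Proof. by apply/forallP => i; rewrite perm1 !mxE lez_nat leq_addl. Qed.

Let jt1 : jt b 1 = content f0.
Proof.
apply/ffunP => i; rewrite content_f0 ffunE perm1 !mxE.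
by rewrite PoszD addrK absz_nat.
Qed.

(** The row indices within a column are distinct naturals: their sum is least
    when they fill the top of the column. *)
Let column_min (f : 'I_n -> nat) (g : 'I_n -> 'I_n) (j : 'I_n) :
  (forall k k', f k = f k' -> g k = g k' -> k = k') ->
  let c := #|[set k | g k == j]| in
  (sumn (iota 0 c) <= \sum_(k | g k == j) f k)%N /\
  ((\sum_(k | g k == j) f k = sumn (iota 0 c))%N ->
     forall i, (exists2 k, g k = j & f k = i) <-> (i < c)%N).
Proof.
move=> fgi c; pose s := [seq f k | k <- enum [set k | g k == j]].
have us : uniq s.
  rewrite map_inj_in_uniq ?enum_uniq // => k k'; rewrite !mem_enum !inE.
  by move=> /eqP ek /eqP ek' e; apply: fgi; rewrite // ek ek'.
have ss : size s = c by rewrite size_map -cardE.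
have es : (\sum_(k | g k == j) f k = sumn s)%N.
  by rewrite sumnE big_map big_enum /=; apply: eq_bigl => k; rewrite inE.
have [le1 le2] := sumn_uniq_min us; rewrite -ss es; split=> // /le2 mi i.
have := mi i; rewrite mem_iota add0n /= => <-; split.
  by move=> [k gk <-]; apply/map_f; rewrite mem_enum inE gk.
by move=> /mapP[k]; rewrite mem_enum inE => /eqP gk ->; exists k.
Qed.

Let column_f0 (j : 'I_n) :
  (\sum_(k | g0 k == j) f0 k = sumn (iota 0 #|[set k | g0 k == j]|))%N.
Proof.
set A := [set k | g0 k == j].
have inA k : k \in A -> g0 k = j :> nat by rewrite inE => /eqP ->.
have fi : {in A &, injective f0}.
  by move=> k k' /inA ek /inA ek' e; apply: cell_inj; rewrite ?e ?ek ?ek'.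
have sub i : (i < #|A|)%N -> exists2 k, k \in A & f0 k = i :> nat.
  move=> lt; have [k kA le] : exists2 k, k \in A & (i <= f0 k)%N.
    apply/exists_inP; rewrite -[X in is_true X]negbK negb_exists_in; apply/negP.
    move=> /forall_inP h; have : (#|f0 @: A| <= i)%N.
      have [iN|iN] := ltnP i N.
        rewrite -(card_ord_ltn (ltnW iN)) subset_leq_card //.
        by apply/fintype.subsetP => _ /imsetP[k kA ->]; rewrite inE ltnNge h.
      by apply: leq_trans (max_card _) _; rewrite card_ord.
    by rewrite card_in_imset // leqNgt lt.
  have [|k' e1 e2] := @cell_ex i j.
    rewrite -(inA _ kA); apply: leq_trans (cell_lt k) _.
    exact: nth_part.
  by exists k' => //; rewrite inE; apply/eqP/val_inj.
pose s := [seq (f0 k : nat) | k <- enum A].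
have us : uniq s.
  by rewrite map_inj_in_uniq ?enum_uniq // => k k'; rewrite !mem_enum => kA k'A /val_inj; apply: fi.
have ss : size s = #|A| by rewrite size_map -cardE.
have sub_s : {subset iota 0 #|A| <= s}.
  by move=> i; rewrite mem_iota /= => /sub[k kA <-]; apply/map_f; rewrite mem_enum.
have [|_ mi] := uniq_min_size (iota_uniq _ _) sub_s; first by rewrite ss size_iota.
transitivity (sumn s).
  by rewrite sumnE big_map big_enum /=; apply: eq_bigl => k; rewrite inE.
by apply/perm_sumn/uniq_perm => //; exact: iota_uniq.
Qed.

(** By [column_min] the sum of the row indices is at least that of the diagram.
    On the other hand the exponents [jt b s] make it smaller than that by half
    the sum of the squares of the [s i - i]. So [s = 1], and equality in every
    column forces the pairs to fill the diagram. *)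
Let extremal (f : {ffun 'I_n -> 'I_N}) (g : {ffun 'I_n -> 'I_n}) (s : 'S_N) :
  jt_ok b s -> content f = jt b s -> content g = content g0 ->
  (forall k k', f k = f k' -> g k = g k' -> k = k') ->
  s = 1%g /\ forall k, (g k < nth 0%N la (f k))%N.
Proof.
move=> /forallP ok cf cg fgi.
have fgi' k k' : f k = f k' :> nat -> g k = g k' -> k = k' by move=> /val_inj; apply: fgi.
have c_eq j : #|[set k | g k == j]| = #|[set k | g0 k == j]|.
  by have /ffunP/(_ j) := cg; rewrite !ffunE.
have split_f (h : 'I_n -> nat) (u : 'I_n -> 'I_n) :
    (\sum_k h k = \sum_j \sum_(k | u k == j) h k)%N.
  by rewrite (partition_big u xpredT) //; apply: eq_bigr => j _; apply: eq_bigl.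
have col_le j : (\sum_(k | g0 k == j) f0 k <= \sum_(k | g k == j) f k)%N.
  by rewrite column_f0 -c_eq; have [] := column_min j fgi'.
have sum_le : (\sum_k f0 k <= \sum_k f k)%N.
  rewrite (split_f (fun k => f k) g) (split_f (fun k => f0 k) g0).
  by apply: leq_sum => j _; apply: col_le.
pose d i : int := (s i : nat)%:Z - (i : nat)%:Z.
(* the sum of the squares of the [s i] is that of the [i] *)
have sq0 : \sum_(i < N) (2 * ((i : nat)%:Z * d i) + d i ^+ 2) = 0.
  rewrite (eq_bigr (fun i : 'I_N => (s i : nat)%:Z ^+ 2 - (i : nat)%:Z ^+ 2)); last first.
    by move=> i _; rewrite /d; ring.
  by rewrite sumrB [X in _ - X](reindex_inj (@perm_inj _ s)) subrr.
have diff : (\sum_k f k)%N%:Z - (\sum_k f0 k)%N%:Z = \sum_(i < N) (i : nat)%:Z * d i.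
  rewrite !Posz_sum.
  rewrite -(sum_content_word (fun i : 'I_N => (i : nat)%:Z) f).
  rewrite -(sum_content_word (fun i : 'I_N => (i : nat)%:Z) f0) -sumrB.
  apply: eq_bigr => i _; rewrite -mulr_natr -[X in _ - X]mulr_natr -mulrBr; congr (_ * _).
  rewrite !natz content_f0 cf ffunE gez0_abs ?subr_ge0 // /d !mxE.
  by have := ltn_ord i; have := ltn_ord (s i); rewrite /=; lia.
have sqs : \sum_i d i ^+ 2 = - 2 * ((\sum_k f k)%N%:Z - (\sum_k f0 k)%N%:Z).
  rewrite diff; move/eqP: sq0; rewrite big_split /= -mulr_sumr addrC addr_eq0 => /eqP ->.
  by rewrite mulNr.
have d0 i : d i = 0.
  have sq_le : \sum_i d i ^+ 2 <= 0 by rewrite sqs; lia.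
  have sq_ge j : true -> 0 <= d j ^+ 2 by rewrite sqr_ge0.
  have /eqP : \sum_i d i ^+ 2 = 0 by apply/le_anti; rewrite sq_le sumr_ge0.
  rewrite psumr_eq0 // => /allP/(_ i); rewrite mem_index_enum => /(_ isT).
  by rewrite sqrf_eq0 => /eqP.
have s1 : s = 1%g.
  by apply/permP => i; rewrite perm1; apply: val_inj; have := d0 i; rewrite /d /=; lia.
split=> // k.
have col_eq j : (\sum_(k | g k == j) f k = \sum_(k | g0 k == j) f0 k)%N.
  have : (\sum_k f k = \sum_k f0 k)%N.
    by apply/eqP; rewrite -eqz_nat -subr_eq0 diff big1 // => i _; rewrite d0 mulr0.
  rewrite (split_f (fun k => f k) g) (split_f (fun k => f0 k) g0) => e.
  have [_] := leqif_sum (fun j (_ : true) => leqif_eq (col_le j)).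
  by rewrite e eqxx => /esym/forallP/(_ j)/eqP.
have [_ /(_ _)] := column_min (g k) fgi'.
rewrite col_eq column_f0 c_eq => /(_ erefl (f k)) [/(_ _)] lt _.
have {lt} : (f k < #|[set k0 | g0 k0 == g k]|)%N by apply: lt; exists k.
have fgi0 k1 k2 : f0 k1 = f0 k2 :> nat -> g0 k1 = g0 k2 -> k1 = k2.
  by move=> e1 e2; apply: cell_inj; rewrite ?e1 ?e2.
have [_ /(_ (column_f0 _)) h] := column_min (g k) fgi0.
by move/(h (f k)) => [k0 <- <-]; apply: cell_lt.
Qed.

Definition pairw r (p : {ffun 'I_n -> 'I_N} * {ffun 'I_n -> 'I_r}) :
  {ffun 'I_n -> 'I_N * 'I_r} := [ffun k => (p.1 k, p.2 k)].

Definition inj_pairs (r : nat) (t : {ffun 'I_N -> nat}) (c : {ffun 'I_r -> nat}) :=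
  [set p : {ffun 'I_n -> 'I_N} * {ffun 'I_n -> 'I_r} |
    [&& content p.1 == t, content p.2 == c &
        injectiveb (pairw p)]].

(** By [sgn_stab], summing signs over the permutations that fix two words keeps
    only those pairs of words in which no pair of letters occurs twice. *)
Lemma sgn_xi_xi (r : nat) (t : {ffun 'I_N -> nat}) (c : {ffun 'I_r -> nat}) :
  \sum_(w : 'S_n) xi t w * ((-1) ^+ w * xi c w) = #|inj_pairs t c|%:R.
Proof.
pose F (p : {ffun 'I_n -> 'I_N} * {ffun 'I_n -> 'I_r}) : rat :=
  ((content p.1 == t) && (content p.2 == c))%:R.
transitivity (\sum_(w : 'S_n) \sum_(p | fixes w (pairw p))
    F p * (-1) ^+ w).
  apply: eq_bigr => w _; rewrite mulrCA -mulr_suml [RHS]mulrC; congr (_ * _).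
  rewrite /xi big_distrlr pair_big /=; apply: eq_big => [[f g]|[f g] _] /=.
    apply/andP/fixesP => [[/fixesP hf /fixesP hg] k|h]; first by rewrite !ffunE /= hf hg.
    by split; apply/fixesP => k; have := h k; rewrite !ffunE => -[].
  by rewrite /F -natrM mulnb.
rewrite (exchange_big_dep xpredT) //=.
transitivity (\sum_p F p * (injectiveb (pairw p))%:R).
  by apply: eq_bigr => p _; rewrite -mulr_sumr sgn_stab.
rewrite -sum1_card natr_sum [RHS]big_mkcond; apply: eq_bigr => p _.
by rewrite /F -natrM mulnb inE andbA; case: ifP.
Qed.

Let inj_pairs_ne1 (s : 'S_N) : jt_ok b s -> s != 1%g ->
  #|inj_pairs (jt b s) (content g0)| = 0%N.
Proof.
move=> ok s1; apply: eq_card0 => -[f g]; rewrite inE /=; apply/negP.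
move=> /and3P[/eqP cf /eqP cg /injectiveP fgi]; case/eqP: s1.
have [] // := extremal ok cf cg.
by move=> k k' e1 e2; apply: fgi; rewrite !ffunE e1 e2.
Qed.

Let inj_pairs_1 : #|inj_pairs (content f0) (content g0)| = n`!.
Proof.
pose F (w : 'S_n) := ([ffun k => f0 (w k)], [ffun k => g0 (w k)]).
have Fi : injective F.
  move=> w w' [/ffunP e1 /ffunP e2]; apply/permP => k.
  by apply: cell_inj; [have := e1 k|have := e2 k]; rewrite !ffunE => ->.
rewrite -card_Sn -(card_imset _ Fi); apply: eq_card => -[f g].
apply/idP/imsetP => [|[w _ [-> ->]]]; rewrite inE /=; last first.
  rewrite !content_comp !eqxx /=; apply/injectiveP => k k'; rewrite !ffunE => -[] e1 e2.
  by apply: (@perm_inj _ w); apply: cell_inj; rewrite ?ffunE /= ?e1 ?e2.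
move=> /and3P[/eqP cf /eqP cg /injectiveP fgi].
have fgi' k k' : f k = f k' -> g k = g k' -> k = k'.
  by move=> e1 e2; apply: fgi; rewrite !ffunE e1 e2.
have [_ lt] := extremal jt_ok1 (etrans cf (esym jt1)) cg fgi'.
have ex k : exists w, (f0 w == f k) && (g0 w == g k).
  have [w e1 e2] := cell_ex (lt k); exists w.
  by apply/andP; split; apply/eqP/val_inj.
pose w0 k := xchoose (ex k).
have w0P k : f0 (w0 k) = f k /\ g0 (w0 k) = g k.
  by have /andP[/eqP-> /eqP->] := xchooseP (ex k).
have wi : injective w0.
  move=> k k' e; apply: fgi'; first by rewrite -(w0P k).1 e (w0P k').1.
  by rewrite -(w0P k).2 e (w0P k').2.
exists (perm wi) => //; congr pair; apply/ffunP => k; rewrite ffunE permE.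
  by rewrite (w0P k).1.
by rewrite (w0P k).2.
Qed.

(** Let A be the permutation character of the row stabilizer and B the induced
    sign character of the column stabilizer. The determinantal character has
    norm 1, hence is an irreducible character up to sign. Its leading term is A,
    which has inner product 1 with B, and the other terms of its expansion are
    orthogonal to B by [extremal]. So the sign is positive, and the irreducible
    character, being a constituent of B, occurs in A. *)
Lemma chiE : chi n la = XC n b.
Proof.
have sb : \sum_i b 0 i = \sum_i delta N 0 i + n%:Z by rewrite sum_beads // sn.
pose A : 'CF([set: 'S_n]) := xiC n (content f0).
pose B : 'CF([set: 'S_n]) := xiC n (content g0) * sgn_cfun n.
have sgnE w : sgn_cfun n w = ratr ((-1) ^+ w).
  by rewrite /sgn_cfun /= cfunElock ?rmorph_sign.
have BE w : B w = ratr ((-1) ^+ w * xi (content g0) w).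
  by rewrite /B cfunE xiCE sgnE -rmorphM mulrC.
have fact_nz : n`!%:R != 0 :> rat by rewrite pnatr_eq0 -lt0n fact_gt0.
have xiB t : '[xiC n t, B] = ratr (n`!%:R^-1 * #|inj_pairs t (content g0)|%:R).
  by rewrite (cfdot_ratr (xiCE t) BE) sgn_xi_xi.
have AE : 'Ind[[set: 'S_n]] (1 : 'CF(row_stab n la)) = A.
  apply/cfunP => w; rewrite xiCE; apply: Ind_level_stab => k.
  by rewrite ffunE.
have BE' : 'Ind[[set: 'S_n]] ('Res[col_stab n la] (sgn_cfun n)) = B.
  rewrite -['Res[_] _]mul1r cfIndM ?finset.subsetT //; congr (_ * _).
  apply/cfunP => w; rewrite xiCE; apply: Ind_level_stab => k.
  by rewrite ffunE.
have cA : A \is a character by exact: xiC_char.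
have cB : B \is a character.
  by rewrite rpredM ?sgn_char ?xiC_char.
have AB : '[A, B] = 1 by rewrite xiB inj_pairs_1 mulVf // rmorph1.
have Xeq : XC n b = A + \sum_(s : 'S_N | s != 1%g)
    (-1) ^+ s *: (if jt_ok b s then xiC n (jt b s) else 0).
  by rewrite /XC (bigD1 1%g) //= odd_perm1 expr0 scale1r jt_ok1 jt1.
have orthB (s : 'S_N) : s != 1%g -> jt_ok b s -> '[xiC n (jt b s), B] = 0.
  by move=> s1 ok; rewrite xiB inj_pairs_ne1 // mulr0 rmorph0.
have XB : '[XC n b, B] = 1.
  rewrite Xeq cfdotDl AB cfdot_suml big1 ?addr0 // => s s1.
  rewrite cfdotZl; case: ifP => [ok|_]; last by rewrite cfdot0l mulr0.
  by rewrite orthB ?mulr0.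
have X1 : '[XC n b] = 1.
  by apply: XC_norm => //; [exact: beads_ge0|exact: beads_inj].
have [e [j Xj]] := vchar_norm1P (XC_vchar n b) X1.
have jB_nat : '['chi_j, B] \is a Num.nat by rewrite Cnat_cfdot_char ?irr_char.
have e0 : e = false.
  case: e Xj => // Xj; move: XB; rewrite Xj cfdotZl expr1 mulN1r.
  case/natrP: jB_nat => k -> /eqP; rewrite eqr_oppLR => /eqP e1.
  by have := ler0n algC k; rewrite e1 oppr_ge0 ler10.
have {e e0} Xj : XC n b = 'chi_j by rewrite Xj e0 scale1r.
have jB : j \in irr_constt B.
  by rewrite irr_consttE cfdotC fmorph_eq0 -Xj XB oner_eq0.
have jA : j \in irr_constt A.
  have : '[XC n b, 'chi_j] = 1 by rewrite -Xj.
  rewrite Xeq cfdotDl cfdot_suml big1 ?addr0 => [e|s s1].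
    by rewrite irr_consttE e oner_eq0.
  rewrite cfdotZl; case: ifP => [ok|_]; last by rewrite cfdot0l mulr0.
  apply/eqP; rewrite mulf_eq0; apply/orP; right; apply: contraT => nz.
  have := constt_ortho_char (xiC_char _ (jt b s)) cB nz jB (orthB s s1 ok).
  by rewrite cfdot_irr eqxx => /eqP; rewrite oner_eq0.
by rewrite /chi AE BE' (pick_constt cA cB AB jA jB) Xj.
Qed.

End Specht.

(** * Reduction to power sums *)

(** The coefficient of x^b y^g in Cauchy's determinant multiplied by the power
    sums p_rho(x) p_rho(y). *)
Fixpoint G (N : nat) (rho : seq nat) (b g : 'rV[int]_N) : rat :=
  if rho is m :: rho' then
    \sum_x \sum_y G rho' (b - unitv m x) (g - unitv m y)
  else Dp b g.

Definition with_first (r m : nat) (t : {ffun 'I_r -> nat}) : {ffun 'I_r.+1 -> nat} :=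
  [ffun k => if unlift ord0 k is Some l then t l else m].

Lemma with_first_subm r m (t : {ffun 'I_r -> nat}) i l :
  subm (with_first m t) i (lift ord0 l) = with_first m (subm t i l).
Proof.
apply/ffunP => k; rewrite !ffunE; case: unliftP => [j ->|->].
  by rewrite ffunE (inj_eq lift_inj).
by rewrite (negPf (neq_lift _ _)) mul0n subn0.
Qed.

Lemma sum_subm r (t : {ffun 'I_r -> nat}) i l : (i <= t l)%N ->
  (\sum_k subm t i l k + i = \sum_k t k)%N.
Proof.
move=> le; rewrite (bigD1 l) //= [RHS](bigD1 l) //= ffunE eqxx mul1n.
rewrite (eq_bigr t) => [|k ne]; last by rewrite ffunE (negPf ne) mul0n subn0.
by rewrite addnAC subnK.
Qed.

(** Newton's identity in a layer other than the first reduces it and produces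
    one more power sum in both sets of variables; when these layers are empty,
    Cauchy's identity applies. The entry [m] of the first layer is never
    divided by, so that the constants depend on [t] alone. *)
Lemma U_power_sums r (t : {ffun 'I_r -> nat}) :
  exists cs : seq (rat * seq nat), all (fun p => sumn p.2 == \sum_k t k)%N cs /\
  forall (N n m : nat) (b g : 'rV[int]_N), (m + \sum_k t k <= n)%N ->
    \sum_i b 0 i = \sum_i delta N 0 i + (m + \sum_k t k)%N%:Z ->
    \sum_i g 0 i = \sum_i delta N 0 i + (m + \sum_k t k)%N%:Z ->
  U n (with_first m t) b g = \sum_(p <- cs) p.1 * G p.2 b g.
Proof.
have [e] := ubnP (\sum_k t k)%N; elim: e t => // e IH t; rewrite ltnS => te.
have [/forallP t0|] := boolP [forall l, t l == 0%N].
  have st : (\sum_k t k = 0)%N by apply: big1 => k _; apply/eqP.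
  exists [:: (1, [::])]; split; first by rewrite /= st.
  move=> N n m b g; rewrite st addn0 => mn sb sg.
  rewrite big_seq1 mul1r /= -(@U_single N n r.+1 ord0 m b g mn sb sg); congr U.
  apply/ffunP => k; rewrite !ffunE; case: unliftP => [j ->|->].
    by rewrite (eqP (t0 j)) eq_sym (negPf (neq_lift _ _)).
  by rewrite eqxx mul1n.
rewrite negb_forall => /existsP[l]; rewrite -lt0n => tl0.
have [cs [hcs hU]] : exists cs : seq (rat * seq nat),
    all (fun p => sumn p.2 == \sum_k t k)%N cs /\
    forall (N n m : nat) (b g : 'rV[int]_N), (m + \sum_k t k <= n)%N ->
    \sum_i b 0 i = \sum_i delta N 0 i + (m + \sum_k t k)%N%:Z ->
    \sum_i g 0 i = \sum_i delta N 0 i + (m + \sum_k t k)%N%:Z ->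
    \sum_(i < t l) \sum_x \sum_y U n (with_first m (subm t i.+1 l))
      (b - unitv i.+1 x) (g - unitv i.+1 y) = \sum_(p <- cs) p.1 * G p.2 b g.
  have [k kt] : exists k, t l = k by exists (t l).
  rewrite kt; have : (k <= t l)%N by rewrite kt.
  elim: k {kt} => [|k IHk] kl.
    by exists [::]; split=> // *; rewrite big_ord0 big_nil.
  have [cs [hcs hU]] := IHk (ltnW kl).
  have sk := sum_subm kl.
  have [|cs' [hcs' hU']] := IH (subm t k.+1 l); first by lia.
  exists (cs ++ [seq (p.1, k.+1 :: p.2) | p <- cs']); split.
    rewrite all_cat hcs /= all_map; apply: sub_all hcs' => p /= /eqP->.
    by rewrite addnC sk.
  move=> N n m b g mn sb sg; rewrite big_ord_recr big_cat /=; congr (_ + _); first exact: hU.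
  rewrite big_map /=.
  under [RHS]eq_bigr => p _ do rewrite mulr_sumr.
  rewrite [RHS]exchange_big; apply: eq_bigr => x _ /=.
  under [RHS]eq_bigr => p _ do rewrite mulr_sumr.
  rewrite [RHS]exchange_big; apply: eq_bigr => y _ /=.
  by apply: hU'; rewrite ?sum_unitv ?sb ?sg; lia.
exists [seq ((t l)%:R^-1 * p.1, p.2) | p <- cs]; split; first by rewrite all_map.
move=> N n m b g mn sb sg; rewrite big_map /=.
have tl1 : (t l)%:R != 0 :> rat by rewrite pnatr_eq0 -lt0n.
have st : (\sum_k with_first m t k = m + \sum_k t k)%N.
  rewrite big_ord_recl ffunE unlift_none; congr addn; apply: eq_bigr => k _.
  by rewrite ffunE liftK.
apply: (mulfI tl1).
have := @U_newton N r.+1 n (with_first m t) b g (lift ord0 l); rewrite st => /(_ mn).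
have -> : with_first m t (lift ord0 l) = t l by rewrite ffunE liftK.
move=> ->.
under eq_bigr => p _ do rewrite -mulrA.
rewrite -mulr_sumr mulVKf // -(hU N n m) //.
by apply: eq_bigr => i _; apply: eq_bigr => x _; apply: eq_bigr => y _; rewrite with_first_subm.
Qed.

(** * Derivations acting on determinants *)

Section Derivations.
Variables (R : comPzRingType) (N L : nat).
Implicit Types (X Z : 'M[R]_(N, L)) (A C W : 'M[R]_L) (F : 'M[R]_(N, L) -> R).

Definition upd (p q : nat) (i : 'I_p) (v : 'rV[R]_q) (B : 'M[R]_(p, q)) : 'M[R]_(p, q) :=
  \matrix_(k, l) if k == i then v 0 l else B k l.

Lemma row_upd p q (i : 'I_p) (v : 'rV[R]_q) B : row i (upd i v B) = v.
Proof. by apply/rowP => l; rewrite !mxE eqxx. Qed.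

Lemma row_upd_ne p q (i j : 'I_p) (v : 'rV[R]_q) B : j != i -> row j (upd i v B) = row j B.
Proof. by move=> ne; apply/rowP => l; rewrite !mxE (negPf ne). Qed.

Lemma upd_upd p q (i : 'I_p) (u v : 'rV[R]_q) B : upd i u (upd i v B) = upd i u B.
Proof. by apply/matrixP => k l; rewrite !mxE; case: eqP. Qed.

Lemma upd_upd_ne p q (i j : 'I_p) (u v : 'rV[R]_q) B : i != j ->
  upd i u (upd j v B) = upd j v (upd i u B).
Proof.
move=> ij; apply/matrixP => k l; rewrite !mxE.
by case: eqP => // ->; rewrite (negPf ij).
Qed.

Lemma upd_mul p q s (i : 'I_p) (v : 'rV[R]_q) B (D : 'M[R]_(q, s)) :
  upd i v B *m D = upd i (v *m D) (B *m D).
Proof.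
apply/matrixP => k l; rewrite !mxE; case: eqP => [e|ne].
  by apply: eq_bigr => x _; rewrite mxE e eqxx.
by apply: eq_bigr => x _; rewrite mxE; case: eqP ne.
Qed.

Lemma det_upd p (i : 'I_p) (v : 'rV[R]_p) B :
  \det (upd i v B) = \sum_k v 0 k * cofactor B i k.
Proof.
rewrite (expand_det_row _ i); apply: eq_bigr => k _; rewrite mxE eqxx.
congr (_ * (_ * \det _)); apply/matrixP => x y; rewrite !mxE.
by rewrite eq_sym (negPf (neq_lift _ _)).
Qed.

(** The left-hand side is the derivative of [det] at [B] along [B *m M], which
    is the trace of [B *m M *m \adj B]. *)
Lemma sum_det_upd p (B M : 'M[R]_p) :
  \sum_i \det (upd i (row i (B *m M)) B) = \tr M * \det B.
Proof.
transitivity (\tr (B *m M *m \adj B)).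
  rewrite /mxtrace; apply: eq_bigr => i _; rewrite det_upd !mxE.
  by apply: eq_bigr => k _; rewrite !mxE.
rewrite -mulmxA mxtrace_mulC -mulmxA mul_adj_mx mul_mx_scalar mxtraceZ mulrC //.
Qed.

(** For a function [F] linear in each row, this is the derivative of [F] at [X]
    along [X *m A], that is, the action of [A] on a tensor power by derivations. *)
Definition dL A F X : R := \sum_i F (upd i (row i (X *m A)) X).

Definition multilinear F :=
  forall i X u v c, F (upd i (c *: u + v) X) = c * F (upd i u X) + F (upd i v X).

Lemma dL_ext A F F' : F =1 F' -> dL A F =1 dL A F'.
Proof. by move=> e X; apply: eq_bigr => i _; rewrite e. Qed.

Lemma row_mul_upd (i j : 'I_N) v X A :
  row j (upd i v X *m A) = if j == i then v *m A else row j (X *m A).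
Proof. by rewrite upd_mul; case: eqP => [->|/eqP ne]; rewrite ?row_upd ?row_upd_ne. Qed.

Lemma dL_multilinear A F : multilinear F -> multilinear (dL A F).
Proof.
move=> mF i X u v c; rewrite /dL mulr_sumr -big_split; apply: eq_bigr => j _ /=.
rewrite !row_mul_upd; have [->|ne] := eqVneq j i.
  by rewrite !upd_upd mulmxDl -scalemxAl mF.
by rewrite !(upd_upd_ne _ _ _ ne) mF.
Qed.

Lemma dL_sum A (I : Type) (s : seq I) (c : I -> R) (Fs : I -> 'M[R]_(N, L) -> R) X :
  dL A (fun Y => \sum_(k <- s) c k * Fs k Y) X = \sum_(k <- s) c k * dL A (Fs k) X.
Proof.
rewrite /dL exchange_big; apply: eq_bigr => k _ /=.
by rewrite mulr_sumr.
Qed.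

(** The terms in which the two operators act on different rows commute, and
    those in which they act on the same row multiply the matrices. *)
Lemma dL_comm A C F X : multilinear F ->
  dL A (dL C F) X = dL C (dL A F) X + (dL (A *m C) F X - dL (C *m A) F X).
Proof.
move=> mF; apply/eqP; rewrite addrC -subr_eq; apply/eqP.
have split_ij A1 C1 : dL A1 (dL C1 F) X = dL (A1 *m C1) F X +
    \sum_i \sum_(j | j != i) F (upd j (row j (X *m C1)) (upd i (row i (X *m A1)) X)).
  rewrite /dL -big_split; apply: eq_bigr => i _ /=.
  rewrite (bigD1 i) //= row_mul_upd eqxx upd_upd; congr (_ + _).
    by rewrite -row_mul mulmxA.
  by apply: eq_bigr => j ne; rewrite row_mul_upd (negPf ne).
rewrite !split_ij (exchange_big_dep xpredT) //= opprD addrACA.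
rewrite [X in _ + X](_ : _ = 0) ?addr0 //; apply/eqP; rewrite subr_eq0; apply/eqP.
apply: eq_bigr => j _; apply: eq_big => [i|i ne]; first by rewrite eq_sym.
by rewrite upd_upd_ne // eq_sym.
Qed.

Variable Y : 'M[R]_(L, N).

Definition detY X : R := \det (X *m Y).

Lemma detY_multilinear : multilinear detY.
Proof.
move=> i X u v c; rewrite /detY !upd_mul !det_upd mulr_sumr -big_split.
by apply: eq_bigr => k _ /=; rewrite mulmxDl -scalemxAl !mxE mulrDl mulrA.
Qed.

Lemma dL_detY (W : 'M[R]_(N, L)) X : dL (Y *m W) detY X = \tr (W *m Y) * detY X.
Proof.
rewrite /dL -sum_det_upd; apply: eq_bigr => i _; rewrite /detY upd_mul.
by congr (\det (upd i _ _)); rewrite -row_mul !mulmxA.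
Qed.

End Derivations.

(** An operator acting on the second argument of the pairing det(X Z^T) acts on
    the first one through its transpose. *)
Lemma dL_adj (R : comPzRingType) (N L : nat) (X Z : 'M[R]_(N, L)) (A : 'M[R]_L) :
  \sum_y detY (upd y (row y (Z *m A)) Z)^T X = dL A^T (detY Z^T) X.
Proof.
rewrite /dL /detY; transitivity (\tr (Z *m A *m X^T *m \adj (Z *m X^T))).
  rewrite /mxtrace; apply: eq_bigr => y _.
  rewrite -[\det _]det_tr trmx_mul trmxK upd_mul det_upd mxE.
  by apply: eq_bigr => k _; rewrite -row_mul !mxE.
rewrite -mxtrace_tr !trmx_mul trmxK trmx_adj trmx_mul trmxK mxtrace_mulC /mxtrace.
apply: eq_bigr => i _; rewrite upd_mul det_upd mxE.
by apply: eq_bigr => k _; rewrite -row_mul !mulmxA [row _ _ _ _]mxE [\adj _ _ _]mxE.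
Qed.

(** * Words of moves *)

(** A step down, a step up, and the projection on the positions of beads. *)
Inductive letter := Dn | Up | Pr.

Definition isDn a := if a is Dn then true else false.
Definition isUp a := if a is Up then true else false.

Section Runs.
Variables (bead : pred nat) (L : nat).
Implicit Types (w : seq letter) (x y : nat).

Definition step a x : option nat :=
  match a with
  | Dn => if x is x'.+1 then Some x' else None
  | Up => if (x.+1 < L)%N then Some x.+1 else None
  | Pr => if bead x then Some x else None
  end.

Fixpoint run w x : option nat :=
  if w is a :: w' then obind (run w') (step a x) else Some x.

Lemma run_cat w1 w2 x : run (w1 ++ w2) x = obind (run w2) (run w1 x).
Proof. by elim: w1 x => //= a w1 IH x; case: (step a x) => //= y. Qed.

Lemma run_lt w x y : (x < L)%N -> run w x = Some y -> (y < L)%N.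
Proof.
elim: w x => [|a w IH] x xL /=; first by case=> <-.
case e: (step a x) => [z|//] /=; apply: IH; move: e; case: a => /=.
- by case: x xL => // x xL [<-]; apply: ltnW.
- by case: ifP => // lt [<-].
- by case: ifP => // _ [<-].
Qed.

Lemma run_Dn m x : run (nseq m Dn) x = if (m <= x)%N then Some (x - m)%N else None.
Proof. by elim: m x => [|m IH] [|x] //=; rewrite IH. Qed.

Lemma run_Up m x : (x < L)%N ->
  run (nseq m Up) x = if (x + m < L)%N then Some (x + m)%N else None.
Proof.
elim: m x => [|m IH] x xL /=; first by rewrite addn0 xL.
case: ifP => [h|/negbT]; first by rewrite /= IH // addSnnS.
by rewrite -leqNgt => h; rewrite ifF //; lia.
Qed.

(** Row vectors are acted on from the right, so a word is read from left to
    right, both by [run] and as a product of matrices. *)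
Definition wm w : 'M[rat]_L := \matrix_(x, y) (run w x == Some (y : nat))%:R.

Lemma wm_cat w1 w2 : wm (w1 ++ w2) = wm w1 *m wm w2.
Proof.
apply/matrixP => x y; rewrite !mxE run_cat.
case e: (run w1 x) => [z|] /=; last first.
  by rewrite big1 // => z _; rewrite !mxE e mul0r.
have zL := run_lt (ltn_ord x) e.
rewrite (bigD1 (Ordinal zL)) //= big1 ?addr0 => [|k ne].
  by rewrite !mxE e eqxx mul1r.
rewrite !mxE e (_ : _ == _ = false) ?mul0r //.
by apply/eqP => -[ezk]; case/eqP: ne; apply: val_inj.
Qed.

Lemma wm_Dn_Up m : (wm (nseq m Dn))^T = wm (nseq m Up).
Proof.
apply/matrixP => x y; rewrite !mxE run_Dn run_Up //.
congr (nat_of_bool _)%:R; have xL := ltn_ord x; have yL := ltn_ord y.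
have SE (i j : nat) : (Some i == Some j) = (i == j) by [].
have SN (i : nat) : (None == Some i) = false by [].
by case: leqP => h; case: ltnP => h' //; rewrite ?SE ?SN; lia.
Qed.

Section Functional.
Variable N : nat.
Implicit Types (F : 'M[rat]_(N, L) -> rat) (ws : seq (seq letter)).

Definition dLs ws F := foldr (fun w F => dL (wm w) F) F ws.

Lemma dLs_cat ws1 ws2 F : dLs (ws1 ++ ws2) F = dLs ws1 (dLs ws2 F).
Proof. exact: foldr_cat. Qed.

Lemma dLs_multilinear ws F : multilinear F -> multilinear (dLs ws F).
Proof. by move=> mF; elim: ws => //= w ws; apply: dL_multilinear. Qed.

Lemma dLs_sum ws (I : Type) (s : seq I) (c : I -> rat) (Fs : I -> 'M[rat]_(N, L) -> rat) F X :
  (forall Y, F Y = \sum_(k <- s) c k * Fs k Y) ->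
  dLs ws F X = \sum_(k <- s) c k * dLs ws (Fs k) X.
Proof.
move=> eF; elim: ws X => [|w ws IH] X //=.
by rewrite (dL_ext _ IH) dL_sum.
Qed.

(** The commutator formula [dL_comm], at any place of a product of operators. *)
Lemma dLs_swap ws1 w1 w2 ws2 F X : multilinear F ->
  dLs (ws1 ++ w1 :: w2 :: ws2) F X =
  dLs (ws1 ++ w2 :: w1 :: ws2) F X +
  (dLs (ws1 ++ (w1 ++ w2) :: ws2) F X - dLs (ws1 ++ (w2 ++ w1) :: ws2) F X).
Proof.
move=> mF; rewrite !dLs_cat.
pose Fs : seq (rat * ('M[rat]_(N, L) -> rat)) :=
  [:: (1, dLs (w2 :: w1 :: ws2) F); (1, dLs ((w1 ++ w2) :: ws2) F);
      (-1, dLs ((w2 ++ w1) :: ws2) F)].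
rewrite (@dLs_sum ws1 _ Fs fst snd) => [|Y].
  by rewrite /Fs !big_cons big_nil /= !mul1r mulN1r addr0.
rewrite /Fs !big_cons big_nil /= !mul1r mulN1r addr0 !wm_cat.
by apply: dL_comm; apply: dLs_multilinear.
Qed.

End Functional.
End Runs.

Section Positions.
Variables (N L : nat).
Implicit Types (b g : 'rV[int]_N).

(** The [i]-th row is the unit vector at the position of the bead [i], or 0 when
    that position is outside of 0, ..., L - 1. *)
Definition Xm b : 'M[rat]_(N, L) := \matrix_(i, x) (b 0 i == (x : nat)%:Z)%:R.

Lemma Xm_unitv bead b m i : (b 0 i < L%:Z) ->
  Xm (b - unitv m i) = upd i (row i (Xm b *m wm bead L (nseq m Dn))) (Xm b).
Proof.
move=> biL; apply/matrixP => k y; rewrite !mxE; case: (k =P i) => [->|_]; last first.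
  by rewrite muln0 subr0.
rewrite muln1; have [bi0|bi0] := leP 0 (b 0 i); last first.
  rewrite big1 => [|x _]; last first.
    by rewrite !mxE (_ : _ == _ = false) ?mul0r //; apply/eqP => e; move: bi0; rewrite e.
  by rewrite subr_eq (_ : _ == _ = false) //; apply/eqP => e; move: bi0; rewrite e.
have xL : (absz (b 0%R i) < L)%N by lia.
rewrite (bigD1 (Ordinal xL)) //= big1 ?addr0 => [|x ne]; last first.
  rewrite !mxE (_ : _ == _ = false) ?mul0r //; apply/eqP => e; case/eqP: ne.
  by apply: val_inj; rewrite /= e absz_nat.
have SE (p q : nat) : (Some p == Some q) = (p == q) by [].
rewrite !mxE /= run_Dn gez0_abs // eqxx mul1r; congr (nat_of_bool _)%:R.
rewrite subr_eq -{1}(gez0_abs bi0) -PoszD eqz_nat.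
case: leqP => h; first by rewrite SE; lia.
by apply/negbTE; rewrite neq_ltn; lia.
Qed.

Lemma Dp_detY b g : (forall i, g 0 i < L%:Z) -> Dp b g = detY (Xm g)^T (Xm b).
Proof.
move=> gL; congr (\det _); apply/matrixP => i j; rewrite !mxE.
have [g0|g0] := leP 0 (g 0 j); last first.
  rewrite andbF big1 // => x _; rewrite !mxE.
  by rewrite [_ g _ _ == _](_ : _ = false) ?mulr0 //; apply/eqP => e; move: g0; rewrite e.
have xL : (absz (g 0%R j) < L)%N by have := gL j; lia.
rewrite (bigD1 (Ordinal xL)) //= big1 ?addr0 => [|x ne]; last first.
  rewrite !mxE [_ g _ _ == _](_ : _ = false) ?mulr0 //; apply/eqP => e; case/eqP: ne.
  by apply: val_inj; rewrite /= e absz_nat.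
by rewrite !mxE /= gez0_abs // eqxx mulr1 andbT.
Qed.

Definition downs (rho : seq nat) := [seq nseq m Dn | m <- rho].
Definition ups (rho : seq nat) := rev [seq nseq m Up | m <- rho].

(** Lowering an entry of [b] is a move of a row of [Xm b], and lowering an entry
    of [g] is carried over to [b] by [dL_adj], where it becomes a move up. *)
Lemma G_dLs bead rho b g : (forall i, b 0 i < L%:Z) -> (forall i, g 0 i < L%:Z) ->
  G rho b g = dLs bead (downs rho ++ ups rho) (detY (Xm g)^T) (Xm b).
Proof.
elim: rho b g => [|m rho IH] b g bL gL; first exact: Dp_detY.
have subL (h : 'rV[int]_N) x : (forall i, h 0 i < L%:Z) ->
    forall i, (h - unitv m x) 0 i < L%:Z.
  by move=> hL i; apply: le_lt_trans (hL i); rewrite !mxE lerBlDr lerDl.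
rewrite /downs /ups /= rev_cons -cats1 catA -[LHS]/(\sum_x _).
rewrite dLs_cat /=; apply: eq_bigr => x _.
rewrite -Xm_unitv //.
rewrite (@dLs_sum _ _ _ _ _ (index_enum 'I_N) (fun=> 1) (fun y => detY (Xm (g - unitv m y))^T)).
  by apply: eq_bigr => y _; rewrite mul1r IH //; apply: subL.
move=> Y; rewrite /= -wm_Dn_Up -dL_adj; apply: eq_bigr => y _.
by rewrite mul1r -Xm_unitv.
Qed.

Variable b : 'rV[int]_N.
Hypotheses (b_inj : injective (b 0)) (b_ge0 : forall i, 0 <= b 0 i).
Hypothesis b_lt : forall i, b 0 i < L%:Z.

Definition bead (x : nat) := [exists i, b 0 i == x%:Z].

Local Notation wm := (wm bead L).

Lemma wm_Pr : wm [:: Pr] = (Xm b)^T *m Xm b.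
Proof.
apply/matrixP => x y; rewrite !mxE /=; case: (boolP (bead x)) => /= [/existsP[i /eqP e]|no].
  rewrite (bigD1 i) //= big1 ?addr0 => [|j ne]; last first.
    rewrite !mxE (_ : _ == _ = false) ?mul0r //; apply/eqP => ej.
    by case/eqP: ne; apply: b_inj; rewrite e.
  by rewrite !mxE e eqxx mul1r eqz_nat.
rewrite big1 // => i _; rewrite !mxE (_ : _ == _ = false) ?mul0r //.
by apply: contraNF no => e; apply/existsP; exists i.
Qed.

Lemma Xm_unit : Xm b *m (Xm b)^T = 1%:M.
Proof.
apply/matrixP => i j; rewrite !mxE.
have xL : (absz (b 0%R i) < L)%N by have := b_lt i; have := b_ge0 i; lia.
rewrite (bigD1 (Ordinal xL)) //= big1 ?addr0 => [|x ne]; last first.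
  rewrite !mxE (_ : _ == _ = false) ?mul0r //; apply/eqP => e; case/eqP: ne.
  by apply: val_inj; rewrite /= e absz_nat.
by rewrite !mxE /= gez0_abs // eqxx mul1r (inj_eq b_inj) eq_sym.
Qed.

Definition T ws : rat := dLs bead ws (detY (Xm b)^T) (Xm b).

(** On the determinant det(X Y), the derivative along [X *m Y *m W] is the
    scalar tr(W Y), and [wm [:: Pr]] is [Y *m Y^T] for [Y] the transpose of
    [Xm b]. *)
Lemma T_trace ws w : T (rcons ws (Pr :: w)) = \tr (wm (Pr :: w)) * T ws.
Proof.
rewrite /T -cats1 dLs_cat /= -[Pr :: w]cat1s wm_cat wm_Pr -mulmxA.
rewrite (@dLs_sum _ _ _ _ _ [:: tt] (fun=> \tr (wm [:: Pr] *m wm w)) (fun=> detY (Xm b)^T)).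
  by rewrite big_seq1 wm_Pr mulmxA.
by move=> Y; rewrite big_seq1 dL_detY wm_Pr -mulmxA [in RHS]mxtrace_mulC.
Qed.

Lemma T_swap ws1 w1 w2 ws2 :
  T (ws1 ++ w1 :: w2 :: ws2) = T (ws1 ++ w2 :: w1 :: ws2) +
  (T (ws1 ++ (w1 ++ w2) :: ws2) - T (ws1 ++ (w2 ++ w1) :: ws2)).
Proof. by apply: dLs_swap; apply: detY_multilinear. Qed.

(** The first operator is evaluated at the bead positions themselves, which the
    projection fixes. *)
Lemma T_first w ws : T ((Pr :: w) :: ws) = T (w :: ws).
Proof.
rewrite /T /= /dL; apply: eq_bigr => i _; congr (dLs _ _ _ (upd i (row i _) _)).
by rewrite -[Pr :: w]cat1s wm_cat wm_Pr !mulmxA Xm_unit mul1mx.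
Qed.

Lemma T_nil : T [::] = 1. Proof. by rewrite /T /= /detY Xm_unit det1. Qed.

End Positions.

(** * Traces of words *)

(** For a run of [w] from [x]: it ends at [x + net w], never goes below
    [x - depth w] or above [x + height w], and requires beads at the positions
    [x + o] for [o] in [tests w]. *)
Fixpoint net (w : seq letter) : int :=
  if w is a :: w' then
    match a with Dn => net w' - 1 | Up => net w' + 1 | Pr => net w' end
  else 0.

Fixpoint depth (w : seq letter) : nat :=
  if w is a :: w' then
    match a with Dn => (depth w').+1 | Up => (depth w').-1 | Pr => depth w' end
  else 0%N.

Fixpoint height (w : seq letter) : nat :=
  if w is a :: w' then
    match a with Dn => (height w').-1 | Up => (height w').+1 | Pr => height w' end
  else 0%N.

Fixpoint tests (w : seq letter) : seq int :=
  if w is a :: w' then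
    match a with
    | Dn => [seq o - 1 | o <- tests w']
    | Up => [seq o + 1 | o <- tests w']
    | Pr => 0 :: tests w'
    end
  else [::].

(** Between a lowest and a highest point of its path the word crosses the whole
    range in one direction: with downs only or with ups only. This is why the
    range is bounded by the maximum and not by the sum. *)
Lemma height_depth w :
  [/\ (depth w <= count isDn w)%N, (height w <= count isUp w)%N &
      (height w + depth w <= maxn (count isDn w) (count isUp w))%N].
Proof. by elim: w => [|[] w [h1 h2 h3]] /=; split; rewrite ?add0n ?add1n; lia. Qed.

Lemma net_ge w : - (depth w)%:Z <= net w.
Proof. by elim: w => [|[] w IH] //=; lia. Qed.

Lemma tests_bound w o : o \in tests w -> - (depth w)%:Z <= o <= (height w)%:Z.
Proof.
elim: w o => [|a w IH] o //=; case: a => /=.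
- by move=> /mapP[p /IH h ->]; lia.
- by move=> /mapP[p /IH h ->]; lia.
by rewrite in_cons => /orP[/eqP->|/IH //]; lia.
Qed.

Section Trace.
Variables (bead : pred nat) (L : nat).

Lemma run_low w x : (x < depth w)%N -> run bead L w x = None.
Proof.
elim: w x => [|a w IH] x //; case: a => /=.
- by case: x => //= x; rewrite ltnS; apply: IH.
- by move=> h; case: ifP => //= _; apply: IH; lia.
- by move=> h; case: ifP => //= _; apply: IH.
Qed.

Lemma runE w x : (depth w <= x)%N -> (x + height w < L)%N ->
  run bead L w x =
  if all (fun o => bead (absz (x%:Z + o))) (tests w) then Some (absz (x%:Z + net w))
  else None.
Proof.
elim: w x => [|a w IH] x /=; first by move=> _ _; congr Some; lia.
case: a => /= h1 h2.
- case: x h1 h2 => [//|x] h1 h2; rewrite /= IH; [|lia|lia].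
  rewrite all_map; congr (if _ then Some (absz _) else _); last by lia.
  by apply: eq_all => o /=; congr (bead (absz _)); lia.
- rewrite ifT /=; last by lia.
  rewrite IH; [|lia|lia].
  rewrite all_map; congr (if _ then Some (absz _) else _); last by lia.
  by apply: eq_all => o /=; congr (bead (absz _)); lia.
rewrite addn0.
by case: (bead x) => //=; rewrite IH.
Qed.

Definition top_test (s : seq int) : nat :=
  foldr (fun o m => maxn (if 0 <= o then absz o else 0%N) m) 0%N s.

Lemma top_test_ge s o : o \in 0 :: s -> o <= (top_test s)%:Z.
Proof.
elim: s => [|p s IH]; first by rewrite mem_seq1 => /eqP->.
rewrite !in_cons orbCA /= => /orP[/eqP->|h]; first by case: ifP => ?; lia.
by have := IH h; case: ifP => ?; lia.
Qed.

Lemma top_test_mem s : (top_test s)%:Z \in 0 :: s.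
Proof.
elim: s => [|p s IH] //=; rewrite !in_cons in IH *.
case: (leqP (if 0 <= p then absz p else 0%N) (top_test s)) => h.
  by case/orP: IH => ->; rewrite ?orbT.
by move: h; case: ifP => p0 // _; rewrite gez0_abs // eqxx orbT.
Qed.

(** The distances below the topmost tested position at which beads are required;
    measured from that position the whole condition looks downwards. The
    offset 0 stands for the letter [Pr] put in front of [w]. *)
Definition pattern (w : seq letter) : seq nat :=
  [seq absz ((top_test (tests w))%:Z - o) | o <- 0%Z :: tests w].

Definition span (w : seq letter) : nat := (top_test (tests w) + depth w)%N.

Lemma span_le w : (span w <= maxn (count isDn w) (count isUp w))%N.
Proof.
have [_ _] := height_depth w; apply: leq_trans; rewrite leq_add2r -lez_nat.
have := top_test_mem (tests w); rewrite in_cons => /orP[/eqP->|/tests_bound/andP[] //].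
by [].
Qed.

Lemma pattern_bound w p : p \in pattern w -> (p <= span w)%N.
Proof.
move=> /mapP[o oin ->]; have := top_test_ge oin.
have : - (depth w)%:Z <= o.
  move: oin; rewrite in_cons => /orP[/eqP->|/tests_bound/andP[] //]; lia.
rewrite /span; lia.
Qed.

Lemma pattern0 w : 0%N \in pattern w.
Proof.
apply/mapP; exists (top_test (tests w))%:Z; first exact: top_test_mem.
by rewrite subrr.
Qed.

Variables (N d : nat).
Hypothesis card_beads : #|[set x : 'I_L | bead x]| = N.
Hypothesis filled : forall x, (x < d)%N -> bead x.
Hypothesis room : forall x, bead x -> (x + d < L)%N.

(** Pairs of a bead and a lower hole are the hooks of the partition, with [M]
    the hook length. *)
Definition hook (y M : nat) := [&& bead y, (M <= y)%N & ~~ bead (y - M)%N].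

Definition hook_count (psi : nat -> (nat -> bool) -> bool) : nat :=
  (\sum_(M < d.+1) #|[set y : 'I_L | hook y M && psi M (fun t => bead (y - t)%N)]|)%N.

Definition first_hole (ps : seq nat) (M : nat) (u : nat -> bool) :=
  (M \in ps) && all (fun p => (p < M)%N ==> u p) ps.

(** The [N] beads [y] are of three kinds: those with [y < m], where all
    positions are filled; those below which the pattern is filled; and those
    where it fails, which are counted at the first hole met. *)
Lemma count_pattern (ps : seq nat) (m : nat) : (m <= d)%N ->
  {in ps, forall p, (p <= m)%N} -> 0%N \in ps ->
  (#|[set y : 'I_L | (m <= y)%N && all (fun p => bead (y - p)%N) ps]| +
   hook_count (first_hole ps) + m = N)%N.
Proof.
move=> md psm ps0; rewrite -card_beads -!sum1_card.
have mL : (m <= L)%N.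
  by case: (posnP m) => [->//|m0]; have := room (filled (leq_trans m0 md)); lia.
rewrite -{2}(card_ord_ltn mL) -sum1_card.
have -> : hook_count (first_hole ps) = (\sum_(y : 'I_L) \sum_(M < d.+1)
    (if hook y M && first_hole ps M (fun t => bead (y - t)%N) then 1 else 0))%N.
  rewrite /hook_count exchange_big; apply: eq_bigr => M _.
  by rewrite -sum1_card big_mkcond; apply: eq_bigr => y _; rewrite inE.
rewrite [X in (X + _ + _)%N]big_mkcond [X in (_ + _ + X)%N]big_mkcond.
rewrite [RHS]big_mkcond -!big_split /=; apply: eq_bigr => y _; rewrite !inE.
have [ym|my] := ltnP y m.
  rewrite (filled (leq_trans ym md)) /= big1 // => M _; case: ifP => //.
  by move=> /andP[/and3P[_ My]]; rewrite filled //; lia.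
rewrite addn0 /=; case by_: (bead y); last first.
  rewrite ifF ?big1 // => [M _|]; first by rewrite /hook by_.
  by apply/negP => /allP/(_ _ ps0); rewrite subn0 by_.
case: ifP => [/allP al|/negbT].
  rewrite big1 // => M _; case: ifP => // /andP[/and3P[_ _ nb] /andP[Mps _]].
  by rewrite al in nb.
rewrite -has_predC => /hasP exP.
have exM : exists p, (p \in ps) && ~~ bead (y - p)%N.
  by have [p h1 h2] := exP; exists p; rewrite h1.
case: (ex_minnP exM) => M /andP[Mps nb] Mmin.
have Md : (M < d.+1)%N by rewrite ltnS (leq_trans (psm _ Mps)).
rewrite (bigD1 (Ordinal Md)) //= big1 ?addn0 ?add0n => [|M' ne].
  rewrite /hook by_ nb (leq_trans (psm _ Mps) my) /first_hole Mps /= ifT //.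
  by apply/allP => p pps; apply/implyP; apply: contraTT => nbp; rewrite -leqNgt Mmin // pps.
case: ifP => // /andP[/and3P[_ _ nb'] /andP[M'ps /allP al]].
case/eqP: ne; apply: val_inj => /=; apply/eqP; rewrite eqn_leq Mmin ?M'ps // andbT.
by rewrite leqNgt; apply: contraL nb => lt; rewrite negbK; have := al _ Mps; rewrite lt.
Qed.

(** A run that returns to its start is determined by the highest position that
    it tests, and [count_pattern] counts the possible positions. *)
Lemma trace_word w : (count isDn w <= d)%N -> (count isUp w <= d)%N ->
  \tr (wm bead L (Pr :: w)) =
  (net w == 0)%:R * (N%:R - (span w)%:R - (hook_count (first_hole (pattern w)))%:R).
Proof.
move=> hd hu.
have sp : (span w <= d)%N by apply: leq_trans (span_le w) _; rewrite geq_max hd.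
have [h1 h2 h3] := height_depth w.
have -> : \tr (wm bead L (Pr :: w)) =
    #|[set x : 'I_L | bead x && (run bead L w x == Some (x : nat))]|%:R.
  rewrite /mxtrace -sum1_card natr_sum [RHS]big_mkcond; apply: eq_bigr => x _.
  by rewrite !mxE inE /=; case: (bead x) => //=; case: (run _ _ _ _ == _).
have runx (x : 'I_L) : bead x -> (run bead L w x == Some (x : nat)) =
    [&& net w == 0, (depth w <= x)%N & all (fun o => bead (absz ((x : nat)%:Z + o))) (tests w)].
  move=> bx; have [lt|le] := ltnP x (depth w); first by rewrite run_low // andbF.
  rewrite runE //; last by have := room bx; lia.
  case: all; rewrite /= ?andbF // andbT.
  have SE (p q : nat) : (Some p == Some q) = (p == q) by [].
  rewrite SE; have := net_ge w; lia.
have [net0|net1] := eqVneq (net w) 0; last first.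
  rewrite mul0r eq_card0 // => x; rewrite inE; case bx: (bead x) => //=.
  by rewrite runx // (negPf net1).
rewrite mul1r; have := count_pattern sp (@pattern_bound w) (pattern0 w).
set tp := top_test (tests w).
set A := [set y | _]; set B := [set x | _] => e.
suff -> : #|B| = #|A| by rewrite -e !natrD; ring.
(* on beads [x + tp] is less than [L]; elsewhere the default does not matter *)
pose f (x : 'I_L) : 'I_L := insubd x (x + tp)%N.
have tpd : (tp <= d)%N by move: sp; rewrite /span -/tp; lia.
have fE (x : 'I_L) : bead x -> f x = (x + tp)%N :> nat.
  by move=> bx; rewrite /f val_insubd ifT //; have := room bx; lia.
have inB (x : 'I_L) : (x \in B) =
    [&& bead x, (depth w <= x)%N & all (fun o => bead (absz ((x : nat)%:Z + o))) (tests w)].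
  by rewrite inE; case bx: (bead x) => //=; rewrite runx // net0.
have patE (x : nat) : (depth w <= x)%N ->
    all (fun p => bead (x + tp - p)%N) (pattern w) =
    bead x && all (fun o => bead (absz (x%:Z + o))) (tests w).
  move=> dx; rewrite /pattern /= -/tp; congr andb; first by congr bead; lia.
  rewrite all_map; apply: eq_in_all => o ow /=; congr bead.
  have := @top_test_ge (tests w) o; rewrite in_cons ow orbT => /(_ isT); rewrite -/tp.
  by have /andP[] := tests_bound ow; lia.
rewrite -(card_in_imset (f := f) (D := B)) => [|x x']; last first.
  rewrite !inB => /and3P[bx _ _] /and3P[bx' _ _] /(congr1 val) /=.
  by rewrite !fE // => /addIn /val_inj.
apply: eq_card => y; apply/imsetP/idP => [[x + ->]|].
  rewrite inB => /and3P[bx dx tx]; rewrite inE fE // patE // bx tx andbT.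
  by rewrite /span -/tp andbT addnC leq_add2r.
rewrite inE => /andP[sy py]; move: sy; rewrite /span -/tp => sy.
have xL : (y - tp < L)%N by apply: leq_ltn_trans (leq_subr _ _) (ltn_ord y).
have ey : ((y - tp) + tp)%N = y by lia.
move: py; rewrite -{1}ey patE => [/andP[bx tx]|]; last by lia.
exists (Ordinal xL); first by rewrite inB /= bx tx andbT; lia.
by apply: val_inj; rewrite /= fE /= ?ey.
Qed.

End Trace.

(** * Border strips and moves of beads *)

Local Notation skew := Defs.skew.

Section Ribbons.
Local Open Scope fset_scope.
Local Open Scope nat_scope.
Implicit Types (la al : part) (s t : squares).

Lemma partP la : is_part la. Proof. exact: (valP la). Qed.

Lemma row_anti la i j : i <= j -> nth 0 la j <= nth 0 la i.
Proof. exact: nth_part (partP la). Qed.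

Lemma diagram_shape (la : seq nat) x : x \in diagram la ->
  exists i j, x = (i.+1, j.+1) /\ j < nth 0 la i.
Proof.
rewrite in_fset => /allpairsPdep[i [j [hi hj ->]]].
move: hi hj; rewrite !mem_iota => hi hj.
by exists i.-1, j.-1; split; [congr pair|]; lia.
Qed.

Lemma part_ext la al : (forall i, nth 0 la i = nth 0 al i) -> la = al.
Proof.
move=> e; apply: diagram_inj; apply/fsetP => x.
have imp (mu ka : part) : (forall i, nth 0 mu i = nth 0 ka i) ->
    x \in diagram mu -> x \in diagram ka.
  by move=> h /diagram_shape[i [j [-> lt]]]; rewrite mem_diagram -h.
by apply/idP/idP; apply: imp.
Qed.

Lemma subpartP al la : reflect (forall i, nth 0 al i <= nth 0 la i) (subpart al la).
Proof.
apply: (iffP (@fsubsetP _ (diagram al) (diagram la))) => [h i|h x /diagram_shape[i [j [-> lt]]]].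
  rewrite leqNgt; apply/negP; rewrite -mem_diagram => /h.
  by rewrite mem_diagram ltnn.
by rewrite mem_diagram (leq_trans lt).
Qed.

Lemma mem_skew la al i j :
  ((i.+1, j.+1) \in skew la al) = (nth 0 al i <= j < nth 0 la i).
Proof. by rewrite in_fsetD !mem_diagram -leqNgt. Qed.

Lemma skew_shape la al x : x \in skew la al ->
  exists i j, x = (i.+1, j.+1) /\ nth 0 al i <= j < nth 0 la i.
Proof.
move=> xs; have := xs; rewrite in_fsetD => /andP[_ /diagram_shape[i [j [e _]]]].
by exists i, j; rewrite -mem_skew -e.
Qed.

(** The row description of a border strip in the rows [a, ..., b]: consecutive
    rows overlap in exactly one column. *)
Definition ribbon la al a b :=
  [/\ a <= b, forall i, (i < a) || (b < i) -> nth 0 al i = nth 0 la i,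
      forall i, a <= i < b -> (nth 0 al i).+1 = nth 0 la i.+1 &
      nth 0 al b < nth 0 la b].

Lemma ribbon_rows la al a b i : ribbon la al a b ->
  (nth 0 al i < nth 0 la i) = (a <= i <= b).
Proof.
move=> [ab h1 h2 h3]; case: (ltnP i a) => ia /=; first by rewrite h1 ?ia ?ltnn.
case: (ltngtP i b) => ib; last by rewrite ib.
  by rewrite -ltnS h2 ?ia //; have := @row_anti la i i.+1; rewrite leqnSn => /(_ isT); lia.
by rewrite h1 ?ib ?orbT // ltnn.
Qed.

Lemma ribbon_subpart la al a b : ribbon la al a b -> subpart al la.
Proof.
move=> r; apply/subpartP => i; case h: (a <= i <= b).
  by apply: ltnW; rewrite (ribbon_rows _ r).
case: r => _ h1 _ _; rewrite h1 //; lia.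
Qed.

Lemma adj_sym x y : adj x y = adj y x.
Proof. by rewrite /adj; lia. Qed.

Lemma joined_sym s (x y : s) : joined x y = joined y x.
Proof. by apply: sym_connect_sym => u v /=; rewrite adj_sym. Qed.

Lemma joined_trans s (x y z : s) : joined x y -> joined y z -> joined x z.
Proof. exact: connect_trans. Qed.

(** From each square a path leads to the lower left end: to the left along the
    row, and down at its first square. *)
Lemma ribbon_connected la al a b : ribbon la al a b -> connected (skew la al).
Proof.
move=> r; have [ab h1 h2 h3] := r; set s := skew la al.
have base : (b.+1, (nth 0 al b).+1) \in s by rewrite mem_skew leqnn.
split; first by move=> s0; rewrite s0 in base.
suff tob (x : s) : joined x [` base] by move=> x y; rewrite (joined_trans (tob x)) // joined_sym.
have [i [j [ex hij]]] := skew_shape (valP x).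
have [k] := ubnP (j + b - i); elim: k i j x ex hij => // k IH i j x ex hij lt.
have /andP[ai ib] : a <= i <= b by rewrite -(ribbon_rows _ r); lia.
have next y (yin : y \in s) : adj (val x) y -> joined [` yin] [` base] -> joined x [` base].
  by move=> axy; apply: joined_trans; apply: connect1.
have [jl|jl] := ltnP (nth 0 al i) j.
  have yin : (i.+1, j.-1.+1) \in s by rewrite mem_skew; lia.
  apply: (next _ yin); first by rewrite ex /adj /=; lia.
  by apply: (IH i j.-1) => //; lia.
have ej : j = nth 0 al i by lia.
have [bi|ibl] := leqP b i.
  have -> : x = [` base]; last exact: connect0.
  apply: val_inj; rewrite ex /=; have -> : i = b by lia.
  by rewrite ej; have -> : i = b by lia.
have yin : (i.+2, j.+1) \in s.
  by rewrite mem_skew -h2 ?ai // ej ltnSn andbT row_anti.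
apply: (next _ yin); first by rewrite ex /adj /=; lia.
by apply: (IH i.+1 j); rewrite -?mem_skew //; lia.
Qed.

Lemma ribbon_border_strip la al a b : ribbon la al a b -> border_strip (skew la al).
Proof.
move=> r; split; first by exists la, al; split; first exact: ribbon_subpart r.
  exact: ribbon_connected r.
move=> i j [h1 _ _ h4].
have [i0 [j0 [[e1 e2] hij]]] := skew_shape h1; subst i j.
move: h4; rewrite mem_skew => hij'.
have : a <= i0.+1 <= b by rewrite -(ribbon_rows _ r); lia.
have : a <= i0 <= b by rewrite -(ribbon_rows _ r); lia.
have [ab r1 r2 r3] := r.
move=> hi hi'; have cond : a <= i0 < b by lia.
by have := r2 i0 cond; lia.
Qed.

(** An overlap of two columns between consecutive rows gives a 2 x 2 block; no
    overlap disconnects the rows above from those below. *)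
Lemma border_strip_ribbon la al : subpart al la -> border_strip (skew la al) ->
  exists a b, ribbon la al a b.
Proof.
move=> /subpartP sub [_ [ne conn] no22]; set s := skew la al in ne conn no22.
pose P i := nth 0 al i < nth 0 la i.
have exP : exists i, P i.
  have [s0|[x xs]] := fset_0Vmem s; first by case: ne.
  by have [i [j [_ h]]] := skew_shape xs; exists i; rewrite /P; lia.
have boundP i : P i -> i <= size la.
  by rewrite /P; case: (leqP i (size la)) => // h; rewrite (nth_default _ (ltnW h)).
case: (ex_minnP exP) => a Pa amin; case: (ex_maxnP exP boundP) => b Pb bmax.
have eq_out i : ~~ P i -> nth 0 al i = nth 0 la i.
  by move=> nP; apply/eqP; rewrite eqn_leq sub leqNgt.
have step i : a <= i < b -> (nth 0 al i).+1 = nth 0 la i.+1.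
  move=> /andP[ai ib]; apply/eqP; rewrite eqn_leq; apply/andP; split; last first.
    rewrite leqNgt; apply/negP => lt.
    case: (no22 i.+1 (nth 0 al i).+1); rewrite !mem_skew.
    have := @row_anti la i i.+1; have := @row_anti al i i.+1.
    by rewrite leqnSn => /(_ isT) h1 /(_ isT) h2; split; lia.
  rewrite ltnNge; apply/negP => cut.
  (* no square of row [i] is adjacent to one of row [i.+1] *)
  have ain : (a.+1, (nth 0 al a).+1) \in s by rewrite mem_skew leqnn.
  have bin : (b.+1, (nth 0 al b).+1) \in s by rewrite mem_skew leqnn.
  pose D : {pred s} := [pred x : s | (val x).1 <= i.+1].
  have clD : fingraph.closed [rel x y : s | adj (val x) (val y)] D.
    apply: intro_closed => [x y|x y /= xy]; first exact: joined_sym.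
    rewrite !inE => xD; rewrite leqNgt; apply/negP => yD.
    have [p [q [ex hx]]] := skew_shape (valP x).
    have [p' [q' [ey hy]]] := skew_shape (valP y).
    move: (ex : fsval x = _) (ey : fsval y = _) xy xD yD => ex' ey'.
    rewrite ?ex ?ey ?ex' ?ey' /adj /= => xy xD yD.
    have ep : p = i by lia.
    have ep' : p' = i.+1 by lia.
    by move: hx hy; rewrite ep ep'; lia.
  have := closed_connect clD (conn [` ain] [` bin]); rewrite !inE /=; lia.
exists a, b; split=> //; first exact: bmax.
move=> i /orP[lt|lt]; apply: eq_out; apply/negP.
  by move/amin; rewrite leqNgt lt.
by move/bmax; rewrite leqNgt lt.
Qed.

End Ribbons.

Section Moves.
Local Open Scope fset_scope.
Local Open Scope nat_scope.
Implicit Types (la al : part) (s t : squares).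

Definition pos (N : nat) (la : seq nat) (i : nat) := nth 0 la i + (N - i.+1).

Lemma pos_ltn N la i j : i < j < N -> pos N la j < pos N la i.
Proof. by move=> /andP[ij jN]; have := row_anti la (ltnW ij); rewrite /pos; lia. Qed.

Lemma pos_leq N la i j : i <= j < N -> pos N la j <= pos N la i.
Proof. by move=> /andP[ij jN]; have := row_anti la ij; rewrite /pos; lia. Qed.

Definition beadp (N : nat) (la : seq nat) : pred nat := bead (beads N la).

Lemma beadpP N (la : seq nat) y : reflect (exists2 i, i < N & pos N la i = y) (beadp N la y).
Proof.
apply: (iffP existsP) => [[i]|[i iN e]].
  by rewrite mxE eqz_nat => /eqP <-; exists i.
by exists (Ordinal iN); rewrite mxE eqz_nat; apply/eqP.
Qed.

(** Removing the strip in the rows [a, ..., b] moves the bead of row [a] to the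
    hole that becomes the bead of row [b], and shifts the indices of the beads
    in between. *)
Definition moved N la al y M := exists a b,
  [/\ ribbon la al a b, b < N, y = pos N la a, M <= y & y - M = pos N al b].

Lemma ribbon_row_lt N la al a b : size la <= N -> ribbon la al a b -> b < N.
Proof.
move=> sz [_ _ _ lt]; rewrite ltnNge; apply/negP => Nb.
by move: lt; rewrite (nth_default _ (leq_trans sz Nb)).
Qed.

Lemma ribbon_pos_below N la al a b i : ribbon la al a b -> b < i < N ->
  pos N la i < pos N al b.
Proof.
move=> [_ h1 _ _] /andP[bi iN]; have := row_anti al (ltnW bi).
by rewrite h1 ?bi ?orbT // /pos; lia.
Qed.

Lemma ribbon_pos_end N la al a b : ribbon la al a b -> pos N al b < pos N la b.
Proof. by move=> [_ _ _ h]; rewrite /pos ltn_add2r. Qed.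

Lemma ribbon_moved N la al a b : size la <= N -> ribbon la al a b ->
  moved N la al (pos N la a) (pos N la a - pos N al b).
Proof.
move=> sz r; have bN := ribbon_row_lt sz r; exists a, b; split=> //; rewrite ?leq_subr //.
rewrite subKn //; apply: ltnW; apply: leq_trans (ribbon_pos_end N r) _.
by apply: pos_leq; case: r => -> _ _ _.
Qed.

Lemma moved_hook N la al y M : moved N la al y M -> hook (beadp N la) y M.
Proof.
move=> [a [b [r bN ey My eh]]]; have [ab _ _ _] := r.
apply/and3P; split=> //; first by apply/beadpP; exists a; rewrite ?ey // (leq_ltn_trans ab).
apply/beadpP => -[i iN]; rewrite eh => e.
have := ribbon_pos_end N r; case: (leqP i b) => ib.
  by have := @pos_leq N la i b; rewrite ib bN => /(_ isT); lia.
by have := @ribbon_pos_below N _ _ _ _ i r; rewrite ib iN => /(_ isT); lia.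
Qed.

Lemma part_of_rows N (f : nat -> nat) : (forall i, f i.+1 <= f i) ->
  (forall i, N <= i -> f i = 0) -> exists al : part, forall i, nth 0 al i = f i.
Proof.
move=> fS f0.
have anti i j : i <= j -> f j <= f i.
  by move=> /subnK <-; elim: (j - i) => // k IH; apply: leq_trans IH; apply: fS.
have ex0 : exists k, f k == 0 by exists N; rewrite f0.
case: (ex_minnP ex0) => k /eqP fk kmin.
have nz i : i < k -> f i != 0 by move=> ik; apply/negP => /kmin; rewrite leqNgt ik.
have h : is_part (mkseq f k).
  apply/andP; split; last first.
    apply/negP => /mapP[i]; rewrite mem_iota /= => ik e.
    by have := nz i ik; rewrite -e.
  apply/(sortedP 0) => i; rewrite size_mkseq => ik.
  by rewrite (nth_mkseq _ _ ik) (nth_mkseq _ _ (ltnW ik)) /geq /= fS.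
exists (Part h) => i /=; case: (ltnP i k) => ik; first by rewrite nth_mkseq.
by rewrite nth_default ?size_mkseq //; apply/esym/eqP; rewrite -leqn0 -fk anti.
Qed.

(** Moving a bead to a hole and sorting again: if [a] is the row of the bead and
    [b] the last row with a bead above the hole, then the beads of the rows
    after [a] up to [b] advance by one row, which makes each of these rows one
    square shorter than the row it comes from. *)
Lemma hook_moved N la y M : size la <= N -> hook (beadp N la) y M ->
  exists al, moved N la al y M.
Proof.
move=> sz /and3P[/beadpP[a aN ey] My hole]; set h := y - M in hole *.
pose P i := (i < N) && (h < pos N la i).
have hy : h <= y by exact: leq_subr.
have noteq i : i < N -> pos N la i != h.
  by move=> iN; apply: contraNneq hole => e; apply/beadpP; exists i.
have Pa : P a by rewrite /P aN ltn_neqAle eq_sym noteq //= ey.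
have exP : exists i, P i by exists a.
have bdP i : P i -> i <= N by move=> /andP[/ltnW].
case: (ex_maxnP exP bdP) => b /andP[bN hb] bmax.
have ab : a <= b by apply: bmax.
have below i : b < i -> i < N -> pos N la i < h.
  move=> bi iN; rewrite ltn_neqAle noteq //= leqNgt; apply/negP => lt.
  by have := bmax i; rewrite /P iN lt leqNgt bi => /(_ isT).
have la0 i : N <= i -> nth 0 la i = 0.
  by move=> Ni; rewrite nth_default // (leq_trans sz).
pose f i := if (i < a) || (b < i) then nth 0 la i else
            if i < b then (nth 0 la i.+1).-1 else h - (N - b.+1).
have hN : N - b.+1 <= h /\ nth 0 la b.+1 <= h - (N - b.+1).
  have [bN'|bN'] := ltnP b.+1 N; last by rewrite la0 //; lia.
  by have := below b.+1 (leqnn _) bN'; rewrite /pos; lia.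
have hb' : h - (N - b.+1) < nth 0 la b by move: hb; rewrite /pos; lia.
have pos_rows i : i < b -> 0 < nth 0 la i.+1.
  by move=> ib; have := row_anti la (_ : i.+1 <= b); move=> /(_ ib); lia.
have [||al eal] := @part_of_rows N f.
- move=> i; rewrite /f.
  have r1 := row_anti la (leqnSn i); have r2 := row_anti la (leqnSn i.+1).
  have c1 : i = b -> nth 0 la i.+1 = nth 0 la b.+1 by move=> ->.
  have c2 : i.+1 = b -> nth 0 la i.+1 = nth 0 la b by move=> ->.
  have [_ hN2] := hN.
  by do ![case: ifP => ?]; lia.
- move=> i Ni; rewrite /f; have -> : (i < a) || (b < i) by lia.
  exact: la0.
have alb : nth 0 al b = h - (N - b.+1) by rewrite eal /f ltnn (ltnNge b) ab.
exists al, a, b; split; [|by []|by []|by []|by rewrite /pos alb; lia].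
split=> //.
- by move=> i h1; rewrite eal /f h1.
- move=> i /andP[ai ib]; rewrite eal /f ib ifF; last by lia.
  by rewrite prednK // pos_rows.
by rewrite alb.
Qed.

Lemma moved_inj N la al y M y' M' : moved N la al y M -> moved N la al y' M' ->
  y = y' /\ M = M'.
Proof.
move=> [a [b [r bN ey My eh]]] [a' [b' [r' bN' ey' My' eh']]].
have e i : (a <= i <= b) = (a' <= i <= b') by rewrite -(ribbon_rows i r) (ribbon_rows i r').
have [ab _ _ _] := r; have [ab' _ _ _] := r'.
have ea : a = a' by have := e a; have := e a'; lia.
have eb : b = b' by have := e b; have := e b'; lia.
have e1 : y = y' by rewrite ey ey' ea.
have e2 : y - M = y' - M' by rewrite eh eh' eb.
by split=> //; lia.
Qed.

(** The bead [y] determines the first row of the strip, and the hole [y - M] the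
    last one. *)
Lemma moved_fun N la al al' y M : moved N la al y M -> moved N la al' y M -> al = al'.
Proof.
move=> [a [b [r bN ey My eh]]] [a' [b' [r' bN' ey' _ eh']]].
have [ab h1 h2 _] := r; have [ab' h1' h2' _] := r'.
have ea : a = a'.
  case: (ltngtP a a') => // lt; [have := @pos_ltn N la a a'|have := @pos_ltn N la a' a]; lia.
have ends i j al1 al2 c1 c2 : ribbon la al1 c1 i -> ribbon la al2 c2 j -> j < N ->
    pos N al1 i = pos N al2 j -> j <= i.
  move=> r1 r2 jN e; rewrite leqNgt; apply/negP => ij.
  have := ribbon_pos_below r1 (_ : i < j < N); rewrite ij jN => /(_ isT).
  by have := ribbon_pos_end N r2; lia.
have eb : b = b'.
  by apply/eqP; rewrite eqn_leq (ends _ _ _ _ _ _ r' r) ?(ends _ _ _ _ _ _ r r') // -eh -eh'.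
apply: part_ext => i; have [ia|ia] := boolP ((i < a) || (b < i)).
  by rewrite h1 // h1' // -ea -eb.
have [ib|ib] := ltnP i b.
  have := h2 i; have := h2' i; rewrite -ea -eb ib; lia.
have -> : i = b by lia.
by move: eh'; rewrite eh /pos -eb; lia.
Qed.

End Moves.

(** * Border strip classes *)

Section Classes.
Local Open Scope fset_scope.
Local Open Scope nat_scope.
Implicit Types (la al : part) (s t : squares).

(** The squares of a border strip lie on different diagonals, whose numbers range
    from [y - M] to [y - 1]. *)
Lemma moved_card N la al y M : moved N la al y M -> #|` skew la al| <= M.
Proof.
move=> [a [b [r bN ey My eh]]]; have [ab h1 h2 h3] := r.
pose f (x : nat * nat) := x.2.-1 + (N - x.1).
have rows i j : nth 0 al i <= j < nth 0 la i -> a <= i <= b.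
  by move=> h; rewrite -(ribbon_rows i r); lia.
have fi : {in skew la al &, injective f}.
  have key i j i' j' : nth 0 al i <= j < nth 0 la i ->
      nth 0 al i' <= j' < nth 0 la i' -> i < i' -> j' + (N - i'.+1) < j + (N - i.+1).
    move=> h h' ii'; have hi := rows _ _ h; have hi' := rows _ _ h'.
    have := row_anti la ii'; have := h2 i; lia.
  move=> x x' /skew_shape[i [j [-> h]]] /skew_shape[i' [j' [-> h']]].
  rewrite /f /=; case: (ltngtP i i') => [lt|lt|->] e; last by congr pair; lia.
    by have := key _ _ _ _ h h' lt; lia.
  by have := key _ _ _ _ h' h lt; lia.
have us : uniq [seq f x | x <- skew la al] by rewrite map_inj_in_uniq ?fset_uniq.
have sub : {subset [seq f x | x <- skew la al] <= iota (y - M) M}.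
  move=> _ /mapP[x /skew_shape[i [j [-> h]]] ->].
  have hi := rows _ _ h.
  rewrite mem_iota subnK // /f /= eh ey /pos.
  have /andP[ai ib] := hi; have := row_anti al ib; have := row_anti la ai; lia.
by have := uniq_leq_size us sub; rewrite size_map size_iota.
Qed.

(** [(i0, j0)] lies on the last diagonal that meets [s], and [(i1, j1)] on the
    first one. *)
Definition ends s i0 j0 i1 j1 := [/\ (i0, j0) \in s,
  forall i j, (i, j) \in s -> j + i0 <= j0 + i, (i1, j1) \in s &
  forall i j, (i, j) \in s -> j1 + i <= j + i1].

(** The square on the diagonal at distance [u] from that of [(i0, j0)] ends its
    row. For a strip removed by moving a bead from [y] down to [y - M], the
    positions [y - u] with [u < M] correspond to its squares, and the beads
    among them to the squares ending their row ([moved_ends]). *)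
Definition row_end s i0 j0 u := exists i j,
  [/\ (i, j) \in s, (i, j.+1) \notin s & j + i0 + u = j0 + i].

Lemma moved_ends N la al y M : moved N la al y M -> exists i0 j0 i1 j1,
  [/\ ends (skew la al) i0 j0 i1 j1, M + i0 + j1 = j0 + i1 + 1 &
      forall u, u < M -> beadp N la (y - u) <-> row_end (skew la al) i0 j0 u].
Proof.
move=> [a [b [r bN ey My eh]]]; have [ab h1 h2 h3] := r.
have rows i j : nth 0 al i <= j < nth 0 la i -> a <= i <= b.
  by move=> h; rewrite -(ribbon_rows i r); lia.
have la_a : nth 0 al a < nth 0 la a by rewrite (ribbon_rows a r) leqnn.
exists a.+1, (nth 0 la a), b.+1, (nth 0 al b).+1; split.
- split; last 2 first.
  + by rewrite mem_skew leqnn.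
  + move=> i' j' /skew_shape[i [j [[-> ->] h]]]; have /andP[ai ib] := rows _ _ h.
    by have := row_anti al ib; lia.
  + by rewrite -(prednK (leq_ltn_trans (leq0n _) la_a)) mem_skew; lia.
  + move=> i' j' /skew_shape[i [j [[-> ->] h]]]; have /andP[ai ib] := rows _ _ h.
    by have := row_anti la ai; lia.
- by move: ey eh; rewrite /pos; lia.
move=> u uM; split=> [/beadpP[i iN e]|[i' [j' [/skew_shape[i [j [[-> ->] h]]]]]]].
  have ib : i <= b.
    rewrite leqNgt; apply/negP => bi.
    by have := @ribbon_pos_below N _ _ _ _ i r; rewrite bi iN => /(_ isT); lia.
  have ai : a <= i.
    by rewrite leqNgt; apply/negP => ia; have := @pos_ltn N la i a; lia.
  have lt : nth 0 al i < nth 0 la i by rewrite (ribbon_rows i r) ai.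
  have e1 := prednK (leq_ltn_trans (leq0n _) lt).
  exists i.+1, (nth 0 la i); rewrite -{1}e1 !mem_skew; split; [lia|lia|].
  by move: e ey; rewrite /pos; lia.
have /andP[ai ib] := rows _ _ h.
rewrite mem_skew => hn e; apply/beadpP; exists i; first exact: leq_ltn_trans bN.
by rewrite ey /pos; lia.
Qed.

Lemma translatesE s t : translates s t -> exists a b : int,
  [/\ forall i j i' j' : nat, i'%:Z = (i%:Z + a)%R -> j'%:Z = (j%:Z + b)%R ->
        ((i, j) \in s) = ((i', j') \in t),
      forall i j, (i, j) \in s -> exists i' j' : nat,
        i'%:Z = (i%:Z + a)%R /\ j'%:Z = (j%:Z + b)%R &
      forall i' j', (i', j') \in t -> exists i j : nat,
        i'%:Z = (i%:Z + a)%R /\ j'%:Z = (j%:Z + b)%R].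
Proof.
move=> [a [b /fsetP e]]; exists a, b.
have st i j : (i, j) \in s -> exists i' j' : nat,
    [/\ (i', j') \in t, i'%:Z = (i%:Z + a)%R & j'%:Z = (j%:Z + b)%R].
  move=> h; have : (i%:Z + a, j%:Z + b)%R \in [fset (Posz x.1 + a, Posz x.2 + b)%R | x in s].
    by apply/imfsetP; exists (i, j).
  rewrite e => /imfsetP[[i' j'] /= h' [-> ->]].
  by exists i', j'.
have ts i' j' : (i', j') \in t -> exists i j : nat,
    [/\ (i, j) \in s, i'%:Z = (i%:Z + a)%R & j'%:Z = (j%:Z + b)%R].
  move=> h; have : (i'%:Z, j'%:Z)%R \in [fset (Posz x.1, Posz x.2) | x in t].
    by apply/imfsetP; exists (i', j').
  by rewrite -e => /imfsetP[[i j] /= h' [-> ->]]; exists i, j.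
split=> [i j i' j' ei ej|i j /st[i' [j' [_ ei ej]]]|i' j' /ts[i [j [_ ei ej]]]].
- apply/idP/idP => [/st[i2 [j2 [h ei2 ej2]]]|/ts[i2 [j2 [h ei2 ej2]]]].
    have -> : i' = i2 by lia.
    by have -> : j' = j2 by lia.
  have -> : i = i2 by lia.
  by have -> : j = j2 by lia.
- by exists i', j'.
- by exists i, j.
Qed.

(** The length [M] and the beads passed are described by the diagonals and the
    ends of rows, which translations preserve. *)
Lemma translates_move N la al y M N' la' al' y' M' :
  moved N la al y M -> moved N' la' al' y' M' ->
  translates (skew la al) (skew la' al') ->
  M = M' /\ forall u, u < M -> beadp N la (y - u) = beadp N' la' (y' - u).
Proof.
set s := skew la al; set t := skew la' al'.
move=> /moved_ends[i0 [j0 [i1 [j1 [[m0 max0 m1 max1] eM pat]]]]].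
move=> /moved_ends[k0 [l0 [k1 [l1 [[n0 nax0 n1 nax1] eM' pat']]]]].
move=> /translatesE[p [q [st s_ex t_ex]]].
have [i0' [j0' [ei0 ej0]]] := s_ex _ _ m0.
have [i1' [j1' [ei1 ej1]]] := s_ex _ _ m1.
have [k0' [l0' [ek0 el0]]] := t_ex _ _ n0.
have [k1' [l1' [ek1 el1]]] := t_ex _ _ n1.
have c0 := nax0 i0' j0'; rewrite -(st _ _ _ _ ei0 ej0) in c0; have {}c0 := c0 m0.
have c1 := nax1 i1' j1'; rewrite -(st _ _ _ _ ei1 ej1) in c1; have {}c1 := c1 m1.
have d0 := max0 k0' l0'; rewrite (st _ _ _ _ ek0 el0) in d0; have {}d0 := d0 n0.
have d1 := max1 k1' l1'; rewrite (st _ _ _ _ ek1 el1) in d1; have {}d1 := d1 n1.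
have MM' : M = M' by lia.
split=> // u uM; apply/idP/idP.
  move/(pat u uM) => [i [j [ij ijn e]]].
  have [i' [j' [ei ej]]] := s_ex _ _ ij.
  apply/pat'; first by rewrite -MM'.
  exists i', j'; split; [by rewrite -(st _ _ _ _ ei ej)| |lia].
  by rewrite -(st i j.+1) //; lia.
rewrite MM' in uM; move/(pat' u uM) => [i' [j' [ij ijn e]]].
have [i [j [ei ej]]] := t_ex _ _ ij.
apply/pat; first by rewrite MM'.
exists i, j; split; [by rewrite (st _ _ _ _ ei ej)| |lia].
by rewrite (st i j.+1 i' j'.+1) //; lia.
Qed.

(** A bijection between the sets of components makes the number of components
    of [t] equal to 1. *)
Lemma iso_connected s t : connected s -> iso s t -> connected t /\ translates s t.
Proof.
move=> cs [f [[g fK gK] ft]].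
have s_in : s \in components s by rewrite components_connected // in_fset1.
have s_uniq (c : components s) : c = [` s_in].
  apply: val_inj => /=; have := valP c; rewrite [in X in _ \in X]components_connected //.
  by rewrite in_fset1 => /eqP.
have t_uniq (c c' : components t) : c = c'.
  by rewrite -(gK c) -(gK c') (s_uniq (g c)) (s_uniq (g c')).
have comp_in (x : t) : component x \in components t by apply: in_imfset.
have ct : connected t.
  split=> [t0|x y].
    have /imfsetP[x _ _] := valP (f [` s_in]).
    by move: (val x) (valP x : val x \in t) => z; rewrite t0 in_fset0.
  have : component x = component y.
    by have := congr1 val (t_uniq [` comp_in x] [` comp_in y]).
  move/fsetP/(_ (val y)) => e.
  have : val y \in component y by apply/imfsetP; exists y; [rewrite inE; exact: connect0|].
  by rewrite -e => /imfsetP[z /= + /val_inj ->]; rewrite inE.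
split=> //; have := ft [` s_in] => /=.
have : val (f [` s_in]) \in components t by apply: valP.
by rewrite [in X in _ \in X]components_connected // in_fset1 => /eqP ->.
Qed.

Lemma iso_border_strip s t : border_strip s -> Defs.is_skew t -> iso s t ->
  [/\ border_strip t, translates s t & dclass s = dclass t].
Proof.
move=> [_ cs no22] tsk ist; have [ct tr] := iso_connected cs ist.
split=> //; last exact: iso_dclass.
split=> // i j [h1 h2 h3 h4].
have [a [b [st _ t_ex]]] := translatesE tr.
have [p [q [ep eq_]]] := t_ex _ _ h1.
by apply: (no22 p q); split; [rewrite (st _ _ i j)|rewrite (st _ _ i j.+1)|
  rewrite (st _ _ i.+1 j)|rewrite (st _ _ i.+1 j.+1)] => //; lia.
Qed.

Lemma iso_refl s : connected s -> iso s s.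
Proof.
move=> cs; apply: translates_iso => //; exists 0%R, 0%R.
by apply/fsetP => z; apply/imfsetP/imfsetP => -[x /= xs ->]; exists x => //;
  rewrite !GRing.addr0.
Qed.

End Classes.

Section HookClasses.
Local Open Scope nat_scope.
Variables (d : nat) (psi : nat -> (nat -> bool) -> bool).
Hypothesis psi_local : forall M u u',
  (forall t, t < M -> u t = u' t) -> psi M u = psi M u'.

Let good N (la : part) y M := (M <= d) && psi M (fun t => beadp N la (y - t)).

(** By [translates_move] the condition [psi] depends only on the class of the
    strip; any of its occurrences may be used to define the weight. *)
Definition class_weight (B : set squares) : bool :=
  `[< exists N (la al : part) y M,
      [/\ moved N la al y M, dclass (skew la al) = B & good N la y M] >].

Lemma moved_border_strip N la al y M : moved N la al y M -> border_strip (skew la al).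
Proof. by move=> [a [b [r _ _ _ _]]]; apply: ribbon_border_strip r. Qed.

Lemma moved_subpart N la al y M : moved N la al y M -> subpart al la.
Proof. by move=> [a [b [r _ _ _ _]]]; apply: ribbon_subpart r. Qed.

Lemma skew_is_skew la al : subpart al la -> Defs.is_skew (skew la al).
Proof. by move=> h; exists la, al. Qed.

Lemma dclass_self N la al y M : moved N la al y M ->
  dclass (skew la al) (skew la al).
Proof.
move=> mv; split; first exact: skew_is_skew (moved_subpart mv).
by apply: iso_refl; case: (moved_border_strip mv).
Qed.

Lemma class_weightE N la al y M : moved N la al y M ->
  class_weight (dclass (skew la al)) = good N la y M.
Proof.
move=> mv; apply/asboolP/idP => [|g]; last by exists N, la, al, y, M.
move=> [N' [la' [al' [y' [M' [mv' e]]]]]]; rewrite /good => /andP[M'd g].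
have [_ ist] : dclass (skew la' al') (skew la al) by rewrite e; apply: dclass_self mv.
have [_ tr _] := iso_border_strip (moved_border_strip mv')
  (skew_is_skew (moved_subpart mv)) ist.
have [eM eb] := translates_move mv' mv tr.
by rewrite -eM M'd -(psi_local eb).
Qed.

(** Hooks correspond to removals of border strips, which are grouped by their
    classes; strips of a class with nonzero weight have at most [d] squares. *)
Lemma hook_count_classes N L (la : part) : size la <= N ->
  (forall i, beads N la 0%R i < L%:Z)%R ->
  ((hook_count (beadp N la) L d psi)%:R : rat) =
  (\sum_(B : bs_vars d) (class_weight (val B))%:R * (rnum la (val B))%:R)%R.
Proof.
(* [K] exceeds all the lengths counted, and all those of removable strips *)
move=> sz bL; pose K := maxn d.+1 L.
pose S : {set 'I_K * 'I_L} := [set p : 'I_K * 'I_L | hook (beadp N la) p.2 p.1].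
pose al (p : 'I_K * 'I_L) : part := xget la [set ka | moved N la ka p.2 p.1]%classic.
have alP p : p \in S -> moved N la (al p) p.2 p.1.
  by rewrite inE => /(hook_moved sz)/xgetPex; apply.
pose cls p := dclass (skew la (al p)).
have al_inj : {in S &, injective al}.
  move=> p p' /alP mv /alP mv' e; rewrite e in mv.
  have [e1 e2] := moved_inj mv mv'.
  by case: p p' e1 e2 {mv mv' e} => [M y] [M' y'] /= /val_inj -> /val_inj ->.
have rnumE (B : bs_vars d) : rnum la (val B) = #|[set p in S | `[< cls p = val B >]]|.
  have [s [bs _ eB]] : bs_classes d (val B).
    by have := valP B; rewrite /= /bs_vars in_fset_set; [move/set_mem|exact: bs_classes_finite].
  rewrite /rnum.
  set A := fset_set _; set S' := [set p in S | _].
  have ul : uniq [seq al p | p <- enum S'].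
    rewrite map_inj_in_uniq ?enum_uniq // => p p'.
    rewrite !mem_enum !finset.in_set => /andP[h _] /andP[h' _].
    by apply: al_inj; rewrite inE.
  rewrite cardE -(size_map al).
  apply/perm_size/uniq_perm => // ka; rewrite in_fset_set; last exact: removals_finite.
  apply/idP/mapP => [/set_mem[sub]|].
    rewrite eB => -[_ ist].
    have [bs' tr ed] := iso_border_strip bs (skew_is_skew sub) ist.
    have [a [b r]] := border_strip_ribbon sub bs'.
    have mv := ribbon_moved sz r; set y := pos N la a in mv; set M := _ - _ in mv.
    have hk := moved_hook mv.
    have yL : y < L.
      have aN : a < N by have [ab _ _ _] := r; apply: leq_ltn_trans ab (ribbon_row_lt sz r).
      by have := bL (Ordinal aN); rewrite mxE ltz_nat.
    have MK : M < K.
      by rewrite /K leq_max; apply/orP; right; case/and3P: hk => _ My _; apply: leq_ltn_trans My yL.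
    have pS : (Ordinal MK, Ordinal yL) \in S by rewrite inE.
    have eal : al (Ordinal MK, Ordinal yL) = ka by apply: moved_fun (alP _ pS) mv.
    exists (Ordinal MK, Ordinal yL) => //; rewrite mem_enum finset.in_set pS /=.
    by apply/asboolP; rewrite /cls eal eB ed.
  move=> [p]; rewrite mem_enum finset.in_set => /andP[pS /asboolP ep] ->; apply: mem_set.
  split; first exact: moved_subpart (alP _ pS).
  by rewrite -ep; apply: dclass_self (alP _ pS).
have clsE p : p \in S -> class_weight (cls p) = good N la p.2 p.1.
  by move=> /alP; apply: class_weightE.
have cls_in p : p \in S -> p.1 <= d -> cls p \in bs_vars d.
  move=> pS pd; have mv := alP _ pS; rewrite in_fset_set; last exact: bs_classes_finite.
  apply: mem_set; exists (skew la (al p)); split=> //; first exact: moved_border_strip mv.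
  rewrite (leq_trans (moved_card mv)) // andbT lt0n cardfs_eq0; apply/eqP.
  by have [_ [ne _] _] := moved_border_strip mv.
have inner p : p \in S -> (\sum_(B : bs_vars d)
    (class_weight (val B))%:R * (`[< cls p = val B >])%:R)%R = ((good N la p.2 p.1)%:R : rat).
  move=> pS; case g: (good N la p.2 p.1); last first.
    apply: big1 => B _; case: asboolP => [e|_]; last by rewrite GRing.mulr0.
    by rewrite -e clsE // g GRing.mul0r.
  have pd : p.1 <= d by move: g => /andP[].
  rewrite (bigD1 [` cls_in p pS pd]%fset) //= clsE // g asboolT // GRing.mulr1.
  rewrite big1 ?GRing.addr0 // => B ne; rewrite asboolF ?GRing.mulr0 // => e.
  by case/eqP: ne; apply: val_inj.
under eq_bigr => B _ do rewrite rnumE -sum1_card GRing.natr_sum big_mkcond GRing.mulr_sumr.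
rewrite exchange_big /=.
transitivity (\sum_(p in S) ((good N la p.2 p.1)%:R : rat))%R; last first.
  rewrite big_mkcond; apply: eq_bigr => p _; case: ifP => pS.
    rewrite -(inner p pS); apply: eq_bigr => B _; rewrite finset.in_set pS /=; case: ifP => //.
  by rewrite big1 // => B _; rewrite finset.in_set pS /= GRing.mulr0.
pose F (M : 'I_K) (y : 'I_L) : rat :=
  if (M, y) \in S then ((good N la y M)%:R)%R else 0%R.
transitivity (\sum_(M < K) \sum_(y < L) F M y)%R; last first.
  by rewrite pair_bigA [RHS]big_mkcond; apply: eq_bigr => -[].
rewrite /hook_count GRing.natr_sum.
rewrite (big_ord_widen K (fun M => (#|[set y : 'I_L | hook (beadp N la) y M &&
   psi M (fun t => beadp N la (y - t)%N)]|%:R : rat)%R)) ?leq_maxl // big_mkcond.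
apply: eq_bigr => M _; rewrite ltnS /=; case: ifP => Md; last first.
  by rewrite big1 // => y _; rewrite /F /good Md; case: ifP.
rewrite -sum1_card GRing.natr_sum big_mkcond; apply: eq_bigr => y _.
by rewrite /F !finset.in_set /good Md /=; case: hook => //=; case: psi.
Qed.

End HookClasses.

(** * Polynomials in the removal numbers *)

Section Polynomiality.
Variable d : nat.

Local Notation v := #|{: bs_vars d}|.

Definition removal_vec (la : part) : 'I_v -> rat :=
  fun i => (rnum la (val (enum_val i)))%:R.

Definition eval_at (la : part) (N : nat) (P : {poly {mpoly rat[v]}}) : rat :=
  (map_poly (meval (removal_vec la)) P).[N%:R].

(** Polynomial dependence on the removal numbers and on the number [N] of beads.
    The bound on [N] ensures that the positions below [d] are filled. *)
Definition polynomial (F : part -> nat -> rat) := exists P : {poly {mpoly rat[v]}},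
  forall (la : part) N, (size la + d <= N)%N -> F la N = eval_at la N P.

Lemma polynomial_ext F F' :
  (forall (la : part) N, (size la + d <= N)%N -> F la N = F' la N) -> polynomial F -> polynomial F'.
Proof. by move=> e [P h]; exists P => la N le; rewrite -e // h. Qed.

Lemma polynomial_const c : polynomial (fun _ _ => c).
Proof.
exists (c%:MP)%:P => la N _.
by rewrite /eval_at map_polyC hornerC /= mevalC.
Qed.

Lemma polynomial_add F F' : polynomial F -> polynomial F' ->
  polynomial (fun la N => F la N + F' la N).
Proof.
move=> [P h] [P' h']; exists (P + P') => la N le.
by rewrite h // h' // /eval_at rmorphD hornerD.
Qed.

Lemma polynomial_mul F F' : polynomial F -> polynomial F' ->
  polynomial (fun la N => F la N * F' la N).
Proof.
move=> [P h] [P' h']; exists (P * P') => la N le.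
by rewrite h // h' // /eval_at rmorphM hornerM.
Qed.

Lemma polynomial_opp F : polynomial F -> polynomial (fun la N => - F la N).
Proof.
move=> /(polynomial_mul (polynomial_const (-1))); apply: polynomial_ext => la N _.
by rewrite mulN1r.
Qed.

Lemma polynomial_N : polynomial (fun _ N => N%:R).
Proof. by exists 'X => la N _; rewrite /eval_at map_polyX hornerX. Qed.

Lemma polynomial_sum (I : eqType) (s : seq I) (F : I -> part -> nat -> rat) :
  (forall i, i \in s -> polynomial (F i)) ->
  polynomial (fun la N => \sum_(i <- s) F i la N).
Proof.
elim: s => [|i s IH] h.
  by apply: polynomial_ext (polynomial_const 0) => la N _; rewrite big_nil.
have := polynomial_add (h i (mem_head _ _)) (IH (fun j js => h j (@mem_behead _ (i :: s) j js))).
by apply: polynomial_ext => la N _; rewrite big_cons.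
Qed.

Lemma polynomial_removals (c : set squares -> rat) :
  polynomial (fun la _ => \sum_(B : bs_vars d) c (val B) * (rnum la (val B))%:R).
Proof.
exists (\sum_(i < v) c (val (enum_val i)) *: 'X_i)%:P => la N _.
rewrite /eval_at map_polyC hornerC /= raddf_sum /=.
rewrite (reindex (@enum_val _ (mem {: bs_vars d}))) /=; last exact/onW_bij/enum_val_bij.
by apply: eq_bigr => i _; rewrite mevalZ mevalXU.
Qed.

Section Beads.
Variables (la : part) (N : nat).
(** The number of positions: no bead leaves this range by moving up by [d]. *)
Definition width := (nth 0%N la 0 + N + d)%N.

Lemma beads_lt_width i : beads N la 0 i < width%:Z.
Proof.
rewrite mxE ltz_nat /width /=; have := row_anti la (leq0n i); have := ltn_ord i; lia.
Qed.

Lemma beadp_room x : beadp N la x -> (x + d < width)%N.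
Proof.
move=> /beadpP[i iN <-]; rewrite /width /pos; have := row_anti la (leq0n i); lia.
Qed.

Lemma card_beadp : #|[set x : 'I_width | beadp N la x]| = N.
Proof.
have posL (i : 'I_N) : (pos N la i < width)%N.
  have : beadp N la (pos N la i) by apply/beadpP; exists i.
  by move/beadp_room; lia.
rewrite -[RHS]card_ord -(card_imset _ (f := fun i : 'I_N => Ordinal (posL i))).
  apply: eq_card => x; rewrite finset.in_set; apply/beadpP/imsetP.
    by move=> [i iN e]; exists (Ordinal iN) => //; apply: val_inj.
  by move=> [i _ ->]; exists i.
move=> i j /(congr1 val) /= e; apply: val_inj => /=.
case: (ltngtP i j) => // lt.
  by have := @pos_ltn N la i j; rewrite lt ltn_ord e ltnn => /(_ isT).
by have := @pos_ltn N la j i; rewrite lt ltn_ord e ltnn => /(_ isT).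
Qed.

Hypothesis le : (size la + d <= N)%N.

Lemma beadp_filled x : (x < d)%N -> beadp N la x.
Proof.
move=> xd; apply/beadpP; exists (N - x.+1)%N; first by lia.
by rewrite /pos nth_default; lia.
Qed.

End Beads.

Lemma first_hole_local ps M u u' : (forall t, (t < M)%N -> u t = u' t) ->
  first_hole ps M u = first_hole ps M u'.
Proof.
move=> e; congr andb; apply: eq_all => p /=.
by case: ltnP => // pM; rewrite e.
Qed.

Lemma polynomial_trace w : (count isDn w <= d)%N -> (count isUp w <= d)%N ->
  polynomial (fun la N => \tr (wm (beadp N la) (width la N) (Pr :: w))).
Proof.
move=> hd hu.
pose c B : rat := (class_weight d (first_hole (pattern w)) B)%:R.
have pol : polynomial (fun la N => (net w == 0)%:R * (N%:R - (span w)%:R -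
    \sum_(B : bs_vars d) c (val B) * (rnum la (val B))%:R)).
  apply: polynomial_mul; first exact: polynomial_const.
  apply: polynomial_add; last exact/polynomial_opp/polynomial_removals.
  apply: polynomial_add; first exact: polynomial_N.
  exact/polynomial_opp/polynomial_const.
apply: polynomial_ext pol => la N le.
rewrite (@trace_word _ _ N d) //; first last.
- exact: beadp_room.
- exact: beadp_filled le.
- exact: card_beadp.
congr (_ * (_ - _)); apply/esym/hook_count_classes; first exact: first_hole_local.
  by apply: leq_trans le; apply: leq_addr.
exact: beads_lt_width.
Qed.

Definition Tw la N ws := T (width la N) (beads N la) ws.

Definition light (ws : seq (seq letter)) :=
  (count isDn (flatten ws) <= d)%N && (count isUp (flatten ws) <= d)%N.

Lemma light_eq ws ws' : light ws ->
  (forall P : pred letter, ~~ P Pr -> count P (flatten ws) = count P (flatten ws')) ->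
  light ws'.
Proof. by rewrite /light => h e; rewrite -!e. Qed.

Lemma light_sub ws ws' : light ws ->
  (forall P : pred letter, count P (flatten ws') <= count P (flatten ws))%N ->
  light ws'.
Proof.
by rewrite /light => /andP[h1 h2] e; rewrite (leq_trans (e _) h1) (leq_trans (e _) h2).
Qed.

Let flatE := (flatten_cat, count_cat).

(** Induction on the number of words. If the last word starts with [Pr], a trace
    splits off. Putting [Pr] in front of the last word is harmless: commute the
    word to the front of the list, where [Pr] makes no difference, then commute
    it back; the commutators merge two words into one. *)
Lemma polynomial_T ws : light ws -> polynomial (fun la N => Tw la N ws).
Proof.
have [q] := ubnP (size ws); elim: q ws => // q IH ws; rewrite ltnS.
have inj la N := beads_inj (N := N) (partP la).
have ge0 la N := beads_ge0 (N := N) la.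
case/lastP: ws => [|ws w] sz li.
  apply: polynomial_ext (polynomial_const 1) => la N le.
  by rewrite /Tw T_nil //; exact: beads_lt_width.
rewrite size_rcons in sz.
have diff ws1 w1 ws2 : (size ws1 + size ws2 < q)%N -> light (ws1 ++ w1 :: ws2) ->
    polynomial (fun la N => Tw la N (ws1 ++ w1 :: ws2) - Tw la N (ws1 ++ (Pr :: w1) :: ws2)).
  elim/last_ind: ws1 ws2 => [|ws1 a IH1] ws2 szq lw.
    apply: polynomial_ext (polynomial_const 0) => la N le.
    rewrite /Tw T_first ?subrr //; exact: beads_lt_width.
  rewrite size_rcons in szq; rewrite cat_rcons in lw.
  have P1 := IH1 (a :: ws2) _ _; have {}P1 := P1 _ _.
  have {P1} : polynomial (fun la N => Tw la N (ws1 ++ w1 :: a :: ws2) -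
      Tw la N (ws1 ++ (Pr :: w1) :: a :: ws2)).
    apply: P1; first by rewrite /= addnS -addSn.
    by apply: light_eq lw _ => P _; rewrite !flatE /= ?count_cat; lia.
  have pT x : light (ws1 ++ x :: ws2) -> polynomial (fun la N => Tw la N (ws1 ++ x :: ws2)).
    by move=> lx; apply: IH lx; rewrite size_cat /= addnS.
  have l1 x : (forall P : pred letter, ~~ P Pr -> count P x = count P a + count P w1)%N ->
      light (ws1 ++ x :: ws2).
    move=> cx; apply: light_eq lw _ => P nP.
    by rewrite !flatE /= ?count_cat cx //; lia.
  have Q1 := pT (a ++ w1) (l1 _ (fun P _ => count_cat P a w1)).
  have Q2 : polynomial (fun la N => Tw la N (ws1 ++ (w1 ++ a) :: ws2)).
    by apply/pT/l1 => P _; rewrite count_cat addnC.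
  have Q3 : polynomial (fun la N => Tw la N (ws1 ++ (a ++ Pr :: w1) :: ws2)).
    by apply/pT/l1 => P nP; rewrite count_cat /= (negPf nP).
  have Q4 : polynomial (fun la N => Tw la N (ws1 ++ ((Pr :: w1) ++ a) :: ws2)).
    by apply/pT/l1 => P nP; rewrite count_cat /= (negPf nP) addnC.
  move=> P1.
  have R1 := polynomial_add P1 (polynomial_add (polynomial_add Q1 (polynomial_opp Q2))
    (polynomial_opp (polynomial_add Q3 (polynomial_opp Q4)))).
  apply: polynomial_ext R1 => la N _; rewrite !cat_rcons /Tw.
  rewrite [T _ _ (ws1 ++ a :: w1 :: ws2)]T_swap [T _ _ (ws1 ++ a :: (Pr :: w1) :: ws2)]T_swap.
  by ring.
have lw : light [:: w].
  by apply: light_sub li _ => P; rewrite -cats1 !flatE leq_addl.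
have lws : light ws.
  by apply: light_sub li _ => P; rewrite -cats1 !flatE leq_addr.
have ptr : polynomial (fun la N => Tw la N (rcons ws (Pr :: w))).
  have := polynomial_mul (polynomial_trace _ _) (IH ws sz lws).
  move=> /(_ w); case/andP: lw; rewrite /= cats0 => -> -> /(_ isT isT).
  apply: polynomial_ext => la N _.
  by rewrite /Tw T_trace //; exact: inj.
have := polynomial_add ptr (diff ws w [::] _ _).
rewrite addn0 cats1 => /(_ sz li); apply: polynomial_ext => la N _.
by rewrite cats1 addrC subrK.
Qed.

Lemma count_nseq_letters rho (P : pred letter) a :
  count P (flatten [seq nseq m a | m <- rho]) = (P a * sumn rho)%N.
Proof. by elim: rho => [|m rho IH] /=; rewrite ?muln0 // count_cat IH count_nseq mulnDr. Qed.

Lemma polynomial_G rho : (sumn rho <= d)%N ->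
  polynomial (fun la N => G rho (beads N la) (beads N la)).
Proof.
move=> le; have li : light (downs rho ++ ups rho).
  have flat_rev (P : pred letter) (s : seq (seq letter)) :
      count P (flatten (rev s)) = count P (flatten s).
    by rewrite !count_flatten map_rev sumn_rev.
  by rewrite /light !flatE /ups !flat_rev !count_nseq_letters /= !mul0n !mul1n addn0 add0n le.
apply: polynomial_ext (polynomial_T li) => la N _.
by rewrite (G_dLs (L := width la N) (bead (beads N la))) // => i; apply: beads_lt_width.
Qed.

End Polynomiality.

(** * The Kronecker coefficient *)

Lemma poly_eventually_const (p : {poly rat}) (a : rat) (N0 : nat) :
  (forall N, (N0 <= N)%N -> p.[N%:R] = a) -> p.[0] = a.
Proof.
move=> h; have [/eqP|nz] := eqVneq (p - a%:P) 0.
  by rewrite subr_eq0 => /eqP ->; rewrite hornerC.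
pose s := [seq N%:R : rat | N <- iota N0 (size (p - a%:P))].
have us : uniq s.
  by rewrite map_inj_uniq ?iota_uniq // => i j /eqP; rewrite eqr_nat => /eqP.
have rts : all (root (p - a%:P)) s.
  apply/allP => x /mapP[N]; rewrite mem_iota => /andP[hN _] ->.
  by rewrite /root hornerD hornerN hornerC h // subrr.
by have := max_poly_roots nz rts us; rewrite size_map size_iota ltnn.
Qed.

Section FirstRow.
Variables (n : nat) (nu : part).
Hypothesis hn : (sumn nu + head 0%N nu <= n)%N.

Lemma add_first_row_nth i : nth 0%N (add_first_row n nu) i =
  if i is j.+1 then nth 0%N nu j else (n - sumn nu)%N.
Proof.
rewrite /add_first_row; case: eqP => [e|_]; last by case: i.
have := partP nu; rewrite /is_part; move: hn e.
case: (part_val nu) => [|m s] /=; first by move=> _ -> _; case: i => [|[|i]].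
by rewrite in_cons => h e /andP[_ /norP[m0 _]]; exfalso; lia.
Qed.

Lemma add_first_row_part : is_part (add_first_row n nu).
Proof.
rewrite /add_first_row; case: eqP => [_|nz]; first exact: partP.
have /andP[snu nu0] := partP nu; apply/andP; split; last first.
  by rewrite in_cons negb_or nu0 andbT; apply/eqP => e; case: nz.
move: snu hn; case: (part_val nu) => [//|m s] /= -> h; rewrite andbT /geq /=; lia.
Qed.

Lemma sumn_add_first_row : sumn (add_first_row n nu) = n.
Proof. by rewrite /add_first_row; case: eqP => [e|_] /=; lia. Qed.

Lemma size_add_first_row : (size (add_first_row n nu) <= (size nu).+1)%N.
Proof. by rewrite /add_first_row; case: eqP => _ //=; apply: leqW. Qed.

End FirstRow.

Section LowerRows.
Variable nu : part.
Local Notation r := (size nu).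
Implicit Type s : 'S_(r.+1).

Definition low_ok s := [forall l : 'I_r,
  (rev_ord (s (lift ord0 l)) <= nth 0%N nu l + rev_ord (lift ord0 l))%N].

(** The Jacobi-Trudi exponents of the rows of [(n - d, nu)] other than the
    first. *)
Definition low_rows s : {ffun 'I_r -> nat} :=
  [ffun l : 'I_r => (nth 0%N nu l + rev_ord (lift ord0 l) - rev_ord (s (lift ord0 l)))%N].

Variable n : nat.
Hypothesis hn : (sumn nu + head 0%N nu <= n)%N.
Let c := beads r.+1 (add_first_row n nu).

Let c0 : c 0 ord0 = (n - sumn nu + r)%N%:Z.
Proof. by rewrite mxE add_first_row_nth //= subn1. Qed.

Let cl l : c 0 (lift ord0 l) = (nth 0%N nu l + rev_ord (lift ord0 l))%N%:Z.
Proof. by rewrite mxE add_first_row_nth. Qed.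

Lemma jt_ok_low s : jt_ok c s = low_ok s.
Proof.
apply/forallP/forallP => [h l|h i].
  by have := h (lift ord0 l); rewrite cl mxE lez_nat.
rewrite [delta _ _ _]mxE; case: (unliftP ord0 i) => [l ->|->].
  by rewrite cl lez_nat.
by rewrite c0 lez_nat /= subSS (leq_trans (leq_subr _ _)) // leq_addl.
Qed.

(** The first row may only gain by permuting the entries of [delta], since it
    starts with the largest one; so the other rows have sum at most [d]. *)
Lemma jt_low s : low_ok s -> exists m,
  [/\ jt c s = with_first m (low_rows s), (\sum_i jt c s i = n)%N,
      (m + \sum_l low_rows s l = n)%N &
      (\sum_l low_rows s l <= sumn nu)%N].
Proof.
move=> ok; have jok : jt_ok c s by rewrite jt_ok_low.
pose m := (n - sumn nu + r - rev_ord (s ord0))%N.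
have e : jt c s = with_first m (low_rows s).
  apply/ffunP => i; rewrite !ffunE; case: (unliftP ord0 i) => [l ->|->].
    by have le := forallP ok l; rewrite cl mxE ffunE subzn.
  rewrite c0 mxE /m subzn // (leq_trans _ (leq_addl _ _)) //.
  by rewrite -ltnS ltn_ord.
have st : (\sum_i jt c s i = n)%N.
  apply/eqP; rewrite -eqz_nat Posz_sum.
  rewrite (eq_bigr (fun i => c 0 i - delta r.+1 0 (s i))) => [|i _]; last first.
    by rewrite ffunE gez0_abs // subr_ge0 (forallP jok).
  have -> : \sum_i (c 0 i - delta r.+1 0 (s i)) = \sum_i c 0 i - \sum_i delta r.+1 0 i.
    by rewrite sumrB; congr (_ - _); rewrite [RHS](reindex_inj (@perm_inj _ s)).
  rewrite sum_beads ?size_add_first_row // sumn_add_first_row //.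
  by rewrite addrAC subrr add0r.
have mn : (n - sumn nu <= m)%N by rewrite /m -addnBA ?leq_addr // -ltnS ltn_ord.
have st' : (m + \sum_l low_rows s l = n)%N.
  rewrite -[RHS]st e big_ord_recl; congr addn; first by rewrite ffunE unlift_none.
  by apply: eq_bigr => l _; rewrite [RHS]ffunE liftK.
by exists m; split=> //; lia.
Qed.

End LowerRows.

Theorem theorem7p4 (d : nat) (nu : part) (hnu : sumn nu = d) :
  exists k : {mpoly rat[#|{: bs_vars d}|]},
    forall (n : nat) (la : part),
      (d + head 0 nu <= n)%N -> sumn la = n ->
      kron n la la (add_first_row n nu) =
        ratr (k.@[fun i => (rnum la (val (enum_val i)))%:R]).
Proof.
have cs_ex (s : 'S_(size nu).+1) : exists cs : seq (rat * seq nat), low_ok s ->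
    all (fun p => sumn p.2 == \sum_k low_rows s k)%N cs /\
    forall (N n m : nat) (b g : 'rV[int]_N), (m + \sum_k low_rows s k <= n)%N ->
    \sum_i b 0 i = \sum_i delta N 0 i + (m + \sum_k low_rows s k)%N%:Z ->
    \sum_i g 0 i = \sum_i delta N 0 i + (m + \sum_k low_rows s k)%N%:Z ->
  U n (with_first m (low_rows s)) b g = \sum_(p <- cs) p.1 * G p.2 b g.
  by have [cs h] := U_power_sums (low_rows s); exists cs.
have [cs csP] := boolp.choice cs_ex.
pose F (la : part) N : rat := \sum_(s : 'S_(size nu).+1) (-1) ^+ s *
  ((low_ok s)%:R * \sum_(p <- cs s) p.1 * G p.2 (beads N la) (beads N la)).
have [P PE] : polynomial d F.
  apply: polynomial_sum => s _; apply: polynomial_mul; first exact: polynomial_const.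
  have [ok|_] := boolP (low_ok s); last first.
    apply: polynomial_ext (polynomial_const d 0) => la N _.
    by rewrite mul0r.
  apply: polynomial_mul; first exact: polynomial_const.
  apply: polynomial_sum => p pcs.
  apply: polynomial_mul; first exact: polynomial_const.
  apply: polynomial_G; have [/allP/(_ p pcs)/eqP-> _] := csP s ok.
  by have [m [_ _ _]] := jt_low (leqnn _) ok; rewrite hnu.
(* the coefficient [P`_0] is the value at [N = 0] *)
exists P`_0 => n la hn sla; rewrite -hnu in hn.
have kE N : (size la + d <= N)%N -> kron n la la (add_first_row n nu) = ratr (F la N).
  move=> le; have sz : (size la <= N)%N by apply: leq_trans le; apply: leq_addr.
  pose b := beads N la; pose c := beads (size nu).+1 (add_first_row n nu).
  have sb : \sum_i b 0 i = \sum_i delta N 0 i + n%:Z.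
    by rewrite sum_beads // sla.
  rewrite /kron (chiE (partP la) sla sz).
  rewrite (@chiE n (size nu).+1 _ (add_first_row_part hn)
    (sumn_add_first_row hn) (size_add_first_row n nu)).
  have XXE w : (XC n b * XC n b) w = ratr (X b w * X b w).
    by rewrite cfunE !XCE rmorphM.
  rewrite (cfdot_ratr XXE (XCE c)); congr ratr.
  under eq_bigr => w _ do rewrite [X c w]X_jt mulr_sumr.
  rewrite exchange_big mulr_sumr; apply: eq_bigr => s _ /=.
  rewrite jt_ok_low //.
  have [ok|_] := boolP (low_ok s); last first.
    by rewrite !mul0r mulr0 big1 ?mulr0 // => w _; rewrite mul0r !mulr0.
  have [m [em sj st _]] := jt_low hn ok.
  have [_ hU] := csP s ok.
  rewrite mul1r -(hU N n m b b) ?st // -em.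
  under eq_bigr => w _ do rewrite mul1r mulrCA.
  by rewrite -mulr_sumr group_sum_U // mulrCA mulKf // pnatr_eq0 -lt0n fact_gt0.
have F0 : (map_poly (meval (removal_vec la)) P).[0] = F la (size la + d)%N.
  apply: (@poly_eventually_const _ _ (size la + d)) => N le.
  rewrite -[LHS]/(eval_at la N P) -PE //.
  by apply: (fmorph_inj (ratr : {rmorphism rat -> algC})) => /=; rewrite -!kE.
by rewrite (kE _ (leqnn _)) -F0 horner_coef0 coef_map.
Qed.
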